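(* Let $G$ be a Banach--Lie group and let $(\pi,V)$ be a representation of $G$ on a locally convex space $V$ for which the action $G\times V\to V$, $(g,v)\mapsto \pi(g)v$, is continuous. Let $V^\infty$ be the space of smooth vectors, endowed with the locally convex topology defined by the seminorms $p_n$ ($p$ a continuous seminorm on $V$, $n\in\mathbb{N}_0$) given in the context. Then the action $$\sigma : G\times V^\infty\to V^\infty,\qquad \sigma(g,v):=\pi(g)v,$$ is smooth.
   Context: Calculus: for locally convex spaces $E,F$ and $U\subseteq E$ open, a map $f:U\to F$ is $C^k$ ($k\in\mathbb{N}\cup\{\infty\}$) if it is continuous, the iterated directional derivatives $\mathrm{d}^jf(x)(h_1,\dots,h_j)=(\partial_{h_j}\cdots\partial_{h_1}f)(x)$ exist for all integers $j\le k$, $x\in U$, $h_i\in E$, and all maps $\mathrm{d}^jf:U\times E^j\to F$ are continuous; smooth means $C^\infty$. Manifolds and Lie groups modeled on locally convex spaces are defined with this notion; a Banach--Lie group is one modeled on a Banach space. $\mathfrak g$ denotes the Lie algebra of $G$ and $\exp_G:\mathfrak g\to G$ its exponential function. A representation $\pi:G\to \mathrm{GL}(V)$ is a group homomorphism into the linear automorphisms of $V$. A vector $v\in V$ is smooth if its orbit map $\pi^v:G\to V$, $g\mapsto\pi(g)v$, is smooth; $V^\infty$ is the linear subspace of smooth vectors. For $x\in\mathfrak g$ and $v\in V^\infty$ put $\mathrm{d}\pi(x)v:=\frac{d}{dt}\big|_{t=0}\pi(\exp_G(tx))v$, which again lies in $V^\infty$. Topology on $V^\infty$: fix a norm $\|\cdot\|$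 on $\mathfrak g$ defining its topology with $\|[x,y]\|\le\|x\|\,\|y\|$ for $x,y\in\mathfrak g$. For each continuous seminorm $p$ on $V$ and $n\in\mathbb{N}_0$ let $$p_n(v):=\sup\{p(\mathrm{d}\pi(x_1)\cdots\mathrm{d}\pi(x_n)v): x_i\in\mathfrak g,\ \|x_i\|\le 1\},\qquad v\in V^\infty$$ (so $p_0(v)=p(v)$). The topology on $V^\infty$ is the locally convex topology defined by all these seminorms $p_n$. *)

(* Defs.v *)
From HB Require Import structures.
From mathcomp Require Import all_boot all_order all_algebra.
From mathcomp Require Import all_classical all_reals all_analysis.

Set Implicit Arguments.
Unset Strict Implicit.
Unset Printing Implicit Defensive.
Import Order.TTheory GRing.Theory Num.Theory.
Import numFieldNormedType.Exports.
Local Open Scope classical_set_scope.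
Local Open Scope ring_scope.

(* [tvsType] is locally convex but not separated; as usual in this calculus,   *)
(* locally convex spaces are Hausdorff, so that derivatives are unique.        *)
HB.mixin Record Tvs_isHausdorff (R : numDomainType) V & Tvs R V := {
  tvs_hausdorff : hausdorff_space V
}.

#[short(type="hausdorffTvsType")]
HB.structure Definition HausdorffTvs (R : numDomainType) :=
  {V of Tvs R V & Tvs_isHausdorff R V}.

Section ProdPreTopologicalLmodule.
Context (R : numDomainType) (E F : preTopologicalLmodType R).
HB.instance Definition _ := Topological.on (E * F)%type.
End ProdPreTopologicalLmodule.

(** Calculus. The library's ['D_v f] is restricted to normed spaces.           *)

Section Calculus.
Context {R : realType} {E F : preTopologicalLmodType R}.
Implicit Types (f : E -> F) (U : set E).

Definition diffquot f (h x : E) (t : R) : F := t^-1 *: (f (x + t *: h) - f x).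

Definition dir_derivable f (h x : E) :=
  exists l : F, diffquot f h x t @[t --> 0^'] --> l.

Definition dir_derive (h : E) f (x : E) : F :=
  xget 0 [set l | diffquot f h x t @[t --> 0^'] --> l].

(* [:: h_1; ...; h_j] is sent to x |-> (d_{h_j} ... d_{h_1} f)(x).             *)
Definition iter_dir_derive f (hs : seq E) : E -> F :=
  foldl (fun g h => dir_derive h g) f hs.

(* [f : U -> F] is represented by a total function, of which only the values   *)
(* on the open set [U] matter. The case [j = 0] of the second clause is the    *)
(* continuity of [f]; ['I_j -> E] carries the product topology.                *)
Definition smooth_on U f :=
  (forall (hs : seq E) (h x : E), U x ->
     dir_derivable (iter_dir_derive f hs) h x) /\
  (forall (j : nat) (x : E) (h : {ptws 'I_j -> E}), U x ->
     {for (x, h), continuous (fun p : E * {ptws 'I_j -> E} =>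
       iter_dir_derive f (codom p.2) p.1)}).

End Calculus.

(** Manifolds modeled on [E], given by an atlas.                               *)

Record chart (M E : topologicalType) := Chart {
  dom : set M;
  cod : set E;
  to_model : M -> E;
  of_model : E -> M;
  open_dom : open dom;
  open_cod : open cod;
  to_cod : forall x, dom x -> cod (to_model x);
  of_dom : forall u, cod u -> dom (of_model u);
  to_modelK : forall x, dom x -> of_model (to_model x) = x;
  of_modelK : forall u, cod u -> to_model (of_model u) = u;
  to_continuous : forall x, dom x -> {for x, continuous to_model};
  of_continuous : forall u, cod u -> {for u, continuous of_model}
}.

Section ProdChart.
Context {M N E F : topologicalType} (phi : chart M E) (psi : chart N F).

Let open_setX (S T : topologicalType) (A : set S) (B : set T) :
  open A -> open B -> open (A `*` B).
Proof.
move=> oA oB; rewrite openE => -[x y] [/= Ax By].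
by exists (A, B) => //=; split; exact: open_nbhs_nbhs.
Qed.

Let pair_continuous (S T S' T' : topologicalType) (f : S -> S') (g : T -> T') p :
  {for p.1, continuous f} -> {for p.2, continuous g} ->
  {for p, continuous (fun q : S * T => (f q.1, g q.2))}.
Proof.
move=> cf cg; apply: cvg_pair.
  exact: (continuous_comp cvg_fst cf).
exact: (continuous_comp cvg_snd cg).
Qed.

Let pto (p : M * N) : E * F := (to_model phi p.1, to_model psi p.2).
Let pof (u : E * F) : M * N := (of_model phi u.1, of_model psi u.2).

Let pto_cod p : (dom phi `*` dom psi) p -> (cod phi `*` cod psi) (pto p).
Proof. by move=> [dp1 dp2]; split; exact: to_cod. Qed.

Let pof_dom u : (cod phi `*` cod psi) u -> (dom phi `*` dom psi) (pof u).
Proof. by move=> [cu1 cu2]; split; exact: of_dom. Qed.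

Let ptoK p : (dom phi `*` dom psi) p -> pof (pto p) = p.
Proof. by case: p => x y [/= dx dy]; rewrite /pof /pto /= !to_modelK. Qed.

Let pofK u : (cod phi `*` cod psi) u -> pto (pof u) = u.
Proof. by case: u => x y [/= cx cy]; rewrite /pof /pto /= !of_modelK. Qed.

Let pto_cont p : (dom phi `*` dom psi) p -> {for p, continuous pto}.
Proof. by move=> [dp1 dp2]; apply: pair_continuous; exact: to_continuous. Qed.

Let pof_cont u : (cod phi `*` cod psi) u -> {for u, continuous pof}.
Proof. by move=> [cu1 cu2]; apply: pair_continuous; exact: of_continuous. Qed.

Definition prod_chart : chart (M * N)%type (E * F)%type :=
  Chart (open_setX (open_dom phi) (open_dom psi))
    (open_setX (open_cod phi) (open_cod psi))
    pto_cod pof_dom ptoK pofK pto_cont pof_cont.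

End ProdChart.

Definition id_chart (E : topologicalType) : chart E E :=
  @Chart E E setT setT id id openT openT (fun _ => id) (fun _ => id)
    (fun _ _ => erefl) (fun _ _ => erefl)
    (fun _ _ => cvg_id) (fun _ _ => cvg_id).

Definition prod_atlas (M N E F : topologicalType)
    (A : set (chart M E)) (B : set (chart N F)) :
    set (chart (M * N)%type (E * F)%type) :=
  [set prod_chart phi psi | phi in A & psi in B].

Definition vect_atlas (E : topologicalType) : set (chart E E) :=
  [set id_chart E].
Arguments vect_atlas : clear implicits.

Section Manifolds.
Context {R : realType} {M N : topologicalType} {E F : preTopologicalLmodType R}.

Definition is_atlas (A : set (chart M E)) :=
  (forall x, exists2 phi, A phi & dom phi x) /\
  (forall phi psi, A phi -> A psi ->
     smooth_on [set u | cod phi u /\ dom psi (of_model phi u)]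
       (to_model psi \o of_model phi)).

Definition smooth_map (A : set (chart M E)) (B : set (chart N F)) (f : M -> N) :=
  continuous f /\
  (forall phi psi, A phi -> B psi ->
     smooth_on [set u | cod phi u /\ dom psi (f (of_model phi u))]
       (to_model psi \o f \o of_model phi)).

End Manifolds.

HB.mixin Record isLieGroup (R : realType) (E : tvsType R) G
    & Group G & Topological G := {
  lie_atlas_subdef : set (chart G E);
  lie_atlas_subproof : is_atlas lie_atlas_subdef;
  lie_hausdorff : hausdorff_space G;
  lie_mul_subproof : smooth_map (prod_atlas lie_atlas_subdef lie_atlas_subdef)
    lie_atlas_subdef (fun p : G * G => (p.1 * p.2)%g);
  lie_inv_subproof : smooth_map lie_atlas_subdef lie_atlas_subdef
    (fun x : G => (x^-1)%g)
}.

#[short(type="lieGroupType")]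
HB.structure Definition LieGroup (R : realType) (E : tvsType R) :=
  {G of isLieGroup R E G & Group G & Topological G}.

Section LieGroupTheory.
Context {R : realType} {E : tvsType R} (G : lieGroupType E).

Definition lie_atlas : set (chart G E) := lie_atlas_subdef.

Lemma lie_atlasP : is_atlas lie_atlas.
Proof. exact: lie_atlas_subproof. Qed.

Lemma lie_mul_smooth : smooth_map (prod_atlas lie_atlas lie_atlas) lie_atlas
  (fun p : G * G => (p.1 * p.2)%g).
Proof. exact: lie_mul_subproof. Qed.

Lemma lie_inv_smooth :
  smooth_map lie_atlas lie_atlas (fun x : G => (x^-1)%g).
Proof. exact: lie_inv_subproof. Qed.

End LieGroupTheory.
Arguments lie_atlas {R E} G _.

Definition seminorm (R : realType) (V : lmodType R) (p : V -> R) :=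
  (forall x y, p (x + y) <= p x + p y) /\
  (forall (a : R) x, p (a *: x) = `|a| * p x).

(** The Lie algebra [T_1 G], identified with the model space [E] by means of   *)
(** the differential at [1] of a chart [phi] around [1].                       *)

Section LieAlgebra.
Context {R : realType} {E : tvsType R} {G : lieGroupType E} (phi : chart G E).

(* The left invariant vector field with value [x] at [1], read in [phi].       *)
Definition left_field (x u : E) : E :=
  dir_derive x
    (fun w => to_model phi (of_model phi u * of_model phi w)%g)
    (to_model phi 1%g).

(* The bracket of vector fields is [X, Y] = dY(X) - dX(Y); at [1] the fields   *)
(* take the values [x] and [y].                                                *)
Definition lie_bracket (x y : E) : E :=
  dir_derive x (left_field y) (to_model phi 1%g) -
  dir_derive y (left_field x) (to_model phi 1%g).

Definition lie_algebra_norm (N : E -> R) :=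
  [/\ seminorm N, (forall x, N x = 0 -> x = 0),
      (forall A : set E,
         nbhs 0 A <-> exists2 e, 0 < e & [set x | N x < e] `<=` A) &
      (forall x y, N (lie_bracket x y) <= N x * N y)].

(* [exp_G x] is the value at [1] of the one-parameter subgroup with velocity   *)
(* [x] at [0]; these conditions determine [exp_G].                             *)
Definition is_exponential (expG : E -> G) :=
  forall x : E,
  [/\ smooth_map (vect_atlas R^o) (lie_atlas G) (fun t : R^o => expG (t *: x)),
      (forall s t : R, expG ((s + t) *: x) = (expG (s *: x) * expG (t *: x))%g) &
      dir_derive (1 : R^o) (fun t : R^o => to_model phi (expG (t *: x))) 0 = x].

End LieAlgebra.

Section Representation.
Context {R : realType} {E : tvsType R} {G : lieGroupType E}.
Context {V : hausdorffTvsType R}.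
Implicit Type pi : G -> {linear V -> V}.

Definition is_representation pi :=
  (forall v, pi 1%g v = v) /\ (forall g h v, pi (g * h)%g v = pi g (pi h v)).

Definition smooth_vector pi (v : V) :=
  smooth_map (lie_atlas G) (vect_atlas V) (fun g => pi g v).

Definition smooth_vectors pi : {pred V} := fun v => `[< smooth_vector pi v >].

Definition derived_rep pi (expG : E -> G) (x : E) (v : V) : V :=
  dir_derive (1 : R^o) (fun t : R^o => pi (expG (t *: x)) v) 0.

(* The seminorm [p_n]; the supremum is taken in the extended reals.            *)
Definition derived_seminorm pi expG (N : E -> R) (p : V -> R) (n : nat) (v : V) :
    \bar R :=
  ereal_sup [set (p (foldr (derived_rep pi expG) v xs))%:E |
             xs in [set xs : n.-tuple E | forall i, N (tnth xs i) <= 1]].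

End Representation.

Section SmoothLinear.
Context {R : realType} {E : tvsType R} {V : hausdorffTvsType R}.
Implicit Types (f g : E -> V) (U : set E).

Let cvg_uniq (l m : V) (q : R -> V) :
  q t @[t --> 0^'] --> l -> q t @[t --> 0^'] --> m -> l = m.
Proof. by apply: cvg_unique; exact: (@tvs_hausdorff R V). Qed.

Let dir_deriveP f h x l :
  diffquot f h x t @[t --> 0^'] --> l -> dir_derive h f x = l.
Proof.
move=> fl; rewrite /dir_derive; case: xgetP => [m _ fm|/(_ l)//].
exact: cvg_uniq fm fl.
Qed.

Let dir_deriveK f h x :
  dir_derivable f h x -> diffquot f h x t @[t --> 0^'] --> dir_derive h f x.
Proof. by move=> [l fl]; rewrite (dir_deriveP fl). Qed.

Let pair_continuous (S T T' : topologicalType) (f : S -> T) (g : S -> T') x :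
  {for x, continuous f} -> {for x, continuous g} ->
  {for x, continuous (fun y => (f y, g y))}.
Proof. by move=> cf cg; exact: cvg_pair. Qed.

Let add_continuous_for (W : tvsType R) (T : topologicalType) (f g : T -> W) x :
  {for x, continuous f} -> {for x, continuous g} ->
  {for x, continuous (fun y => f y + g y)}.
Proof.
move=> cf cg; exact: (@continuous_comp _ _ _ _ (fun z : W * W => z.1 + z.2) x
  (pair_continuous cf cg) (@add_continuous W _)).
Qed.

Let scale_continuous_for (W : tvsType R) (T : topologicalType)
    (f : T -> R^o) (g : T -> W) x :
  {for x, continuous f} -> {for x, continuous g} ->
  {for x, continuous (fun y => f y *: g y)}.
Proof.
move=> cf cg; exact: (@continuous_comp _ _ _ _ (fun z : R^o * W => z.1 *: z.2) x
  (pair_continuous cf cg) (@scale_continuous R W _)).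
Qed.

Let near_line U (h x : E) : open U -> U x ->
  \forall t \near (0 : R)^', U (x + t *: h).
Proof.
move=> oU Ux; apply: nbhs_dnbhs.
have cl : {for (0 : R^o), continuous (fun t : R^o => x + t *: h)}.
  apply: add_continuous_for; first exact: cvg_cst.
  by apply: scale_continuous_for; [exact: cvg_id|exact: cvg_cst].
by apply: cl; rewrite scale0r addr0; exact: open_nbhs_nbhs.
Qed.

Lemma continuous_lin (T : topologicalType) (a : R) (f g : T -> V) x :
  {for x, continuous f} -> {for x, continuous g} ->
  {for x, continuous (fun y => a *: f y + g y)}.
Proof.
move=> cf cg; apply: add_continuous_for => //.
by apply: scale_continuous_for => //; exact: cvg_cst.
Qed.

Let diffquot_lin (a : R) U f g k h x : open U -> U x ->
  (forall y, U y -> k y = a *: f y + g y) ->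
  dir_derivable f h x -> dir_derivable g h x ->
  diffquot k h x t @[t --> 0^'] --> a *: dir_derive h f x + dir_derive h g x.
Proof.
move=> oU Ux kE /dir_deriveK df /dir_deriveK dg.
have : (fun t => a *: diffquot f h x t + diffquot g h x t) @ 0^' -->
    a *: dir_derive h f x + dir_derive h g x.
  apply: (@cvg_comp _ _ _ (fun t => (diffquot f h x t, diffquot g h x t))
    (fun z : V * V => a *: z.1 + z.2)
    _ (nbhs (dir_derive h f x, dir_derive h g x))); first exact: cvg_pair.
  exact: (@continuous_lin _ a fst snd (_, _) cvg_fst cvg_snd).
apply: cvg_trans; apply: near_eq_cvg.
apply: filterS (near_line h oU Ux) => t Ut.
rewrite /diffquot !kE// scalerA mulrC -scalerA -scalerDr; congr (_ *: _).
by rewrite scalerBr opprD addrACA.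
Qed.

Let iter_lin (a : R) U f g : open U -> smooth_on U f -> smooth_on U g ->
  forall hs x, U x -> iter_dir_derive (fun y => a *: f y + g y) hs x =
    a *: iter_dir_derive f hs x + iter_dir_derive g hs x.
Proof.
move=> oU [df _] [dg _]; elim/last_ind => [//|hs h ih] x Ux.
rewrite /iter_dir_derive !foldl_rcons -!/(iter_dir_derive _ _).
by apply: dir_deriveP; apply: (diffquot_lin oU Ux ih); [exact: df|exact: dg].
Qed.

Lemma smooth_on_lin (a : R) U f g : open U -> smooth_on U f -> smooth_on U g ->
  smooth_on U (fun y => a *: f y + g y).
Proof.
move=> oU sf sg; have ilin := iter_lin a oU sf sg.
case: sf sg => [df cf] [dg cg]; split=> [hs h x Ux|j x h Ux].
  eexists; apply: (diffquot_lin (a := a) oU Ux (ilin hs)).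
    exact: df.
  exact: dg.
have := @continuous_lin _ a _ _ _ (cf j x h Ux) (cg j x h Ux).
rewrite /prop_for /continuous_at /= -ilin//.
apply: cvg_trans; apply: near_eq_cvg.
exists (U, setT) => /=; first by split; [exact: open_nbhs_nbhs|exact: filterT].
by move=> [y k] [/= Uy _]; rewrite ilin.
Qed.

Lemma smooth_on0 U : smooth_on U (fun=> 0 : V).
Proof.
have q0 (h x : E) : diffquot (fun=> 0 : V) h x t @[t --> 0^'] --> (0 : V).
  rewrite (_ : diffquot _ _ _ = cst 0); first exact: cvg_cst.
  by apply/funext => t; rewrite /diffquot subrr scaler0.
have i0 (hs : seq E) : iter_dir_derive (fun=> 0 : V) hs = (fun=> 0).
  elim/last_ind: hs => [//|hs h ih]; rewrite /iter_dir_derive foldl_rcons.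
  by rewrite -/(iter_dir_derive _ _) ih; apply/funext => x; exact: dir_deriveP.
split=> [hs h x _|j x h _]; first by exists 0; rewrite i0.
rewrite (_ : (fun p => _) = cst 0); first exact: cvg_cst.
by apply/funext => p; rewrite i0.
Qed.

End SmoothLinear.

Section SmoothVectors.
Context {R : realType} {E : tvsType R} {G : lieGroupType E}.
Context {V : hausdorffTvsType R} (pi : G -> {linear V -> V}).

Let dom_vect (phi : chart G E) (psi : chart V V) (f : G -> V) :
  vect_atlas V psi ->
  [set u | cod phi u /\ dom psi (f (of_model phi u))] = cod phi.
Proof. by move=> ->; apply/seteqP; split=> u //= -[]. Qed.

Lemma smooth_vectors_submod_closed : submod_closed (smooth_vectors pi).
Proof.
split=> [|a v w /asboolP[cv sv] /asboolP[cw sw]].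
  apply/asboolP; rewrite /smooth_vector.
  rewrite (_ : (fun g => _) = cst 0); last by apply/funext => g; rewrite linear0.
  split=> [x|phi psi Aphi Apsi]; first exact: cvg_cst.
  by rewrite dom_vect// Apsi; exact: smooth_on0.
apply/asboolP; rewrite /smooth_vector.
rewrite (_ : (fun g => _) = (fun g => a *: pi g v + pi g w)); last first.
  by apply/funext => g; rewrite linearP.
split=> [x|phi psi Aphi Apsi].
  exact: (@continuous_lin _ _ _ a _ _ _ (cv x) (cw x)).
have := sw _ _ Aphi Apsi; have := sv _ _ Aphi Apsi.
rewrite (dom_vect phi (fun g => pi g v) Apsi) (dom_vect phi (fun g => pi g w) Apsi).
rewrite (dom_vect phi (fun g => a *: pi g v + pi g w) Apsi) Apsi; apply: smooth_on_lin; exact: open_cod.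
Qed.

HB.instance Definition _ := GRing.isSubmodClosed.Build R V (smooth_vectors pi)
  smooth_vectors_submod_closed.

End SmoothVectors.

(* The space [V^oo] for [pi]; [expG] and [N] only serve to define its topology.*)
Record smooth_space (R : realType) (E : tvsType R) (G : lieGroupType E)
    (V : hausdorffTvsType R) (pi : G -> {linear V -> V})
    (expG : E -> G) (N : E -> R) := SmoothSpace {
  smooth_val :> V;
  smooth_valP : smooth_val \in smooth_vectors pi
}.

Section SmoothSpace.
Context {R : realType} {E : tvsType R} {G : lieGroupType E}.
Context {V : hausdorffTvsType R} (pi : G -> {linear V -> V}).
Context (expG : E -> G) (N : E -> R).
Local Notation W := (smooth_space pi expG N).

HB.instance Definition _ := [isSub for @smooth_val R E G V pi expG N].
HB.instance Definition _ := [Choice of W by <:].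
HB.instance Definition _ := [SubChoice_isSubLmodule of W by <:].

(* The balls of the seminorms [p_n], a subbase of their topology.              *)
Definition seminorm_balls : set (set W) :=
  [set B | exists (p : V -> R) (n : nat) (v : W) (e : R), [/\ seminorm p,
    continuous p, 0 < e & B = [set w : W |
      (derived_seminorm pi expG N p n (smooth_val w - smooth_val v)%R < e%:E)%E]]].

HB.instance Definition _ := isSubBaseTopological.Build W seminorm_balls id.

End SmoothSpace.

(* Main.v *)
Require Import Defs.
From HB Require Import structures.
From mathcomp Require Import all_boot all_order all_algebra.
From mathcomp Require Import all_classical all_reals all_analysis.
From mathcomp Require Import finmap ring lra.
Import Order.TTheory GRing.Theory Num.Theory.
Import numFieldNormedType.Exports.
Local Open Scope classical_set_scope.
Local Open Scope ring_scope.

Set Implicit Arguments.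
Unset Strict Implicit.
Unset Printing Implicit Defensive.

(* In a chart with inverse [c], write S(u, w) = pi(c(u))w, let k(u, h) be the
   logarithmic derivative of [c] and B(x, w) = dpi(x)w, which is a continuous
   bilinear map into V^oo by the very choice of the seminorms p_n. As maps into
   V^oo,
     dS(u, w)(h, z) = S(u, B(k(u, h), w) + z),
   so S is C^(k+1) as soon as it is C^k, and it remains to see that S is
   continuous and has this derivative. Since dpi(x)pi(g) = pi(g)dpi(Ad(g)^-1 x),
   the operators S(u, -) are locally equicontinuous on V^oo. For fixed
   x_1, ..., x_n the curve dpi(x_1)...dpi(x_n)S(u + th, w) in V is smooth, and
   as the operators dpi(x) are closed, its derivative is
   dpi(x_1)...dpi(x_n)S(u + th, B(k(u + th, h), w)). The mean value inequality
   in V, with bounds uniform in the x_i, then gives continuity and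
   differentiability with respect to every p_n. *)

(** * Seminorms *)

(** The obstacle is the supremum in p_n: that dpi(x_1)...dpi(x_n)pi(c(u))w is smooth in u for each
    choice of the x_i says nothing uniform over the unit balls. Uniformity has three sources. A map
    that is jointly continuous in (u, x) and linear in x is bounded on the unit ball, uniformly for
    u near a given point; this makes p_n finite on V^oo and bounds the operators k(u, -) and
    Ad(c(u))^-1. Each passage of a dpi(x) across pi(c(u)) costs one such bound, so p_n(pi(c(u))w) <=
    C q_n(w) with the same n. Finally, the mean value inequality turns a bound on derivatives that
    is uniform in the x_i into one on increments. Differentiating costs one order, p_n(dpi(x)w) <=
    N(x) p_{n+1}(w), which the family of all p_n absorbs. Closedness enters because dpi(x) is in
    general not continuous for the topology of V, so it cannot simply be exchanged with d/dt. That
    the derivative of the curve exists comes from joint smoothness of (g, u) |->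
    pi(g)dpi(x_1)...dpi(x_n)pi(c(u))w; closedness, itself a mean value estimate along t |-> exp(tx),
    tells what it is. *)

Section LinearFunctions.
Context {R : pzRingType} {X Y : lmodType R} (L : X -> Y).
Hypothesis lL : linear L.

Lemma linearB_of x y : L (x - y) = L x - L y.
Proof. by rewrite addrC -scaleN1r lL scaleN1r addrC. Qed.

Lemma linear0_of : L 0 = 0.
Proof. by have := linearB_of 0 0; rewrite !subrr. Qed.

Lemma linearZ_of a x : L (a *: x) = a *: L x.
Proof. by have := lL a x 0; rewrite linear0_of !addr0. Qed.

Lemma linearD_of x y : L (x + y) = L x + L y.
Proof. by have := lL 1 x y; rewrite !scale1r. Qed.

End LinearFunctions.

Section Seminorms.
Context {R : realType} {X : lmodType R} (p : X -> R).
Hypothesis sp : seminorm p.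

Lemma seminormZ a x : p (a *: x) = `|a| * p x.
Proof. by case: sp => _ ->. Qed.

Lemma seminormD x y : p (x + y) <= p x + p y.
Proof. by case: sp. Qed.

Lemma seminorm0 : p 0 = 0.
Proof. by rewrite -(scale0r 0) seminormZ normr0 mul0r. Qed.

Lemma seminormN x : p (- x) = p x.
Proof. by rewrite -scaleN1r seminormZ normrN1 mul1r. Qed.

Lemma seminormB x y : p (x - y) <= p x + p y.
Proof. by rewrite -(seminormN y) seminormD. Qed.

Lemma seminormC x y : p (x - y) = p (y - x).
Proof. by rewrite -seminormN opprB. Qed.

Lemma seminorm_ge0 x : 0 <= p x.
Proof.
have := seminormD x (- x); rewrite subrr seminorm0 seminormN => h.
by lra.
Qed.

Lemma seminorm_split y x z : p (x - z) <= p (x - y) + p (y - z).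
Proof. by rewrite -{1}(subrK y x) -addrA seminormD. Qed.

End Seminorms.

Section ContinuousSeminorms.
Context {R : realType}.
Implicit Types X Y F : preTopologicalLmodType R.

(* No continuity of the vector space operations is assumed on a
   [preTopologicalLmodType], hence the uniform formulation; on a [tvsType] it
   amounts to continuity ([csn_continuous], [continuous_csn]). *)
Definition csn X (p : X -> R) :=
  seminorm p /\ forall x e, 0 < e -> \forall y \near x, p (y - x) < e.

(* Predicates instead of structures: the smooth vectors form a locally convex
   space only under the hypotheses of the theorem. *)
Definition lcs X := forall (x : X) (A : set X), nbhs x A ->
  exists2 p, csn p & forall y, p (y - x) < 1 -> A y.

Definition separated X := forall x : X, (forall p, csn p -> p x = 0) -> x = 0.

Lemma csnS X (p : X -> R) : csn p -> seminorm p.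
Proof. by case. Qed.

Lemma csn0 X : csn (fun _ : X => 0 : R).
Proof.
split; first by split=> *; rewrite ?addr0 ?mulr0.
by move=> x e e0; exact: filterE.
Qed.

Lemma csnD X (p q : X -> R) : csn p -> csn q -> csn (fun x => p x + q x).
Proof.
move=> [sp cp] [sq cq]; split.
  split=> [x y|a x]; last by rewrite (seminormZ sp) (seminormZ sq) mulrDr.
  by rewrite addrACA lerD// seminormD.
move=> x e e0; have e2 : 0 < e / 2 by rewrite divr_gt0.
by apply: filterS2 (cp x _ e2) (cq x _ e2) => y; lra.
Qed.

Lemma csnZ X (p : X -> R) a : 0 <= a -> csn p -> csn (fun x => a * p x).
Proof.
move=> a0 [sp cp]; split.
  split=> [x y|b x]; last by rewrite (seminormZ sp) mulrCA.
  by rewrite -mulrDr ler_wpM2l// seminormD.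
move=> x e e0; have e1 : 0 < e / (a + 1) by rewrite divr_gt0// ltr_wpDl.
apply: filterS (cp x _ e1) => y; rewrite ltr_pdivlMr ?ltr_wpDl// => h.
by have := seminorm_ge0 sp (y - x); nra.
Qed.

Lemma csn_ball X (p : X -> R) : csn p -> forall x e, 0 < e ->
  nbhs x [set y | p (y - x) < e].
Proof. by case. Qed.

Lemma csn_comp X Y (p : Y -> R) (L : X -> Y) : csn p -> linear L ->
  continuous L -> csn (fun x => p (L x)).
Proof.
move=> [sp cp] lL cL.
split; first split=> [x y|a x].
- by rewrite (linearD_of lL); exact: seminormD.
- by rewrite (linearZ_of lL); exact: seminormZ.
- move=> x e e0; have h : \forall y \near x, p (L y - L x) < e.
    exact: (cL x _ (cp (L x) e e0)).
  by apply: filterS h => y; rewrite (linearB_of lL).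
Qed.

Lemma lcs_cvgP F (T : Type) (fl : set_system T) {ff : Filter fl} (g : T -> F)
  (l : F) :
  lcs F -> (g @ fl --> l) <->
  (forall p e, csn p -> 0 < e -> \forall t \near fl, p (g t - l) < e).
Proof.
move=> lF; split=> [gl p e cp e0|H A /lF[p cp pA]].
  exact: (gl _ (csn_ball cp l e0)).
by apply: filterS (H p 1 cp ltr01) => t; exact: pA.
Qed.

Lemma cvg_csn F (T : Type) (fl : set_system T) (g : T -> F) (l : F) p e :
  g @ fl --> l -> csn p -> 0 < e -> \forall t \near fl, p (g t - l) < e.
Proof. by move=> gl cp e0; exact: (gl _ (csn_ball cp l e0)). Qed.

Lemma lcs_cvg_unique F (T : Type) (fl : set_system T) {pf : ProperFilter fl}
  (g : T -> F) (l m : F) :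
  separated F -> g @ fl --> l -> g @ fl --> m -> l = m.
Proof.
move=> sF gl gm; apply/eqP; rewrite -subr_eq0; apply/eqP/sF => p cp.
apply/eqP; rewrite eq_le seminorm_ge0 ?andbT; last exact: csnS cp.
apply/ler_addgt0Pl => e e0; rewrite addr0.
have e2 : 0 < e / 2 by rewrite divr_gt0.
have [t [h1 h2]] := filter_ex (filterI (cvg_csn gl cp e2) (cvg_csn gm cp e2)).
have := seminorm_split (csnS cp) (g t) l m;
  rewrite (seminormC (csnS cp) l (g t)).
by lra.
Qed.

Lemma lcs_cvgD F (T : Type) (fl : set_system T) {ff : Filter fl} (g h : T -> F)
  (l m : F) :
  lcs F -> g @ fl --> l -> h @ fl --> m ->
  (fun t => g t + h t) @ fl --> l + m.
Proof.
move=> lF gl hm; apply/(lcs_cvgP _ _ lF) => p e cp e0.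
have e2 : 0 < e / 2 by rewrite divr_gt0.
apply: filterS2 (cvg_csn gl cp e2) (cvg_csn hm cp e2) => t h1 h2.
by rewrite opprD addrACA; have := seminormD (csnS cp) (g t - l) (h t - m); lra.
Qed.

Lemma lcs_cvgZ F (T : Type) (fl : set_system T) {ff : Filter fl} (a : T -> R)
  (b : R) (g : T -> F) (l : F) :
  lcs F -> a @ fl --> b -> g @ fl --> l ->
  (fun t => a t *: g t) @ fl --> b *: l.
Proof.
move=> lF ab gl; apply/(lcs_cvgP _ _ lF) => p e cp e0.
have sp := csnS cp; have pl := seminorm_ge0 sp l.
(* The product is split as a(g - l) + (a - b)l. The minimum with 1 in [e2] gives [|a t| <= |b| + 1];
   the added 1 in the denominators avoids division by 0. *)
have e1 : 0 < e / 2 / (`|b| + 1) by rewrite !divr_gt0// ltr_wpDl.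
have e2 : 0 < Num.min 1 (e / 2 / (p l + 1)).
  by rewrite lt_min ltr01 !divr_gt0// ltr_wpDl.
have H : \forall t \near fl, `|b - a t| < Num.min 1 (e / 2 / (p l + 1)).
  by move/cvgrPdist_lt: ab => /(_ _ e2).
apply: filterS2 H (cvg_csn gl cp e1) => t; rewrite lt_min => /andP[h1 h2] h3.
have -> : a t *: g t - b *: l = a t *: (g t - l) + (a t - b) *: l.
  by rewrite scalerBr scalerBl addrA subrK.
apply: (le_lt_trans (seminormD sp _ _)); rewrite !(seminormZ sp) (distrC (a t)).
move: h2 h3; rewrite !ltr_pdivlMr ?ltr_wpDl// => h2 h3.
have h4 : `|a t| <= `|b| + 1.
  have := ler_normB b (b - a t); rewrite subKr; lra.
have := seminorm_ge0 sp (g t - l); have := normr_ge0 (b - a t); nra.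
Qed.

Lemma lcs_cvgZr F (T : Type) (fl : set_system T) {ff : Filter fl} (a : R)
    (g : T -> F) (l : F) :
  lcs F -> g @ fl --> l -> (fun t => a *: g t) @ fl --> a *: l.
Proof. by move=> lF; apply: lcs_cvgZ => //; exact: cvg_cst. Qed.

Lemma lcs_prod X Y : lcs X -> lcs Y -> lcs (X * Y)%type.
Proof.
move=> lX lY [x y] A [[B C] [/= /lX[p cp pB] /lY[q cq qC]] BCA].
exists (fun z : X * Y => p z.1 + q z.2).
  apply: csnD.
    by apply: (@csn_comp (X * Y)%type X p fst) => // z; exact: cvg_fst.
  by apply: (@csn_comp (X * Y)%type Y q snd) => // z; exact: cvg_snd.
move=> [x' y'] /= h; have := seminorm_ge0 (csnS cp) (x' - x).
have := seminorm_ge0 (csnS cq) (y' - y) => h1 h2.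
by apply: (BCA (x', y')); split; [apply: pB|apply: qC] => /=; lra.
Qed.

End ContinuousSeminorms.

(** * The Minkowski gauge *)

Section Gauge.
Context {R : realType} {X : lmodType R} (C : set X).
Hypothesis C_convex : forall x y (k : R), C x -> C y -> 0 <= k <= 1 ->
  C (k *: x + (1 - k) *: y).
Hypothesis C_sym : forall x, C x -> C (- x).
Hypothesis C_absorb : forall x, exists2 r, 0 < r & C (r^-1 *: x).

Let G (x : X) : set R := [set r | 0 < r /\ C (r^-1 *: x)].

Definition gauge (x : X) : R := inf (G x).

Let G_lb x : has_lbound (G x).
Proof. by exists 0 => r [/ltW]. Qed.

Let G_ne x : G x !=set0.
Proof. by have [r r0 Cr] := C_absorb x; exists r. Qed.

Let C0 : C 0.
Proof.
have [r r0] := C_absorb 0; by rewrite scaler0.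
Qed.

Lemma gauge_le x r : 0 < r -> C (r^-1 *: x) -> gauge x <= r.
Proof. by move=> r0 Cr; apply: ge_inf. Qed.

(** Some [s < r] has [s^-1 *: x] in [C], and [r^-1 *: x] lies on the segment from it to 0, which
    belongs to [C]. *)
Lemma gauge_lt x r : gauge x < r -> C (r^-1 *: x).
Proof.
move=> /(inf_lt (G_ne x))[s [s0 Cs] sr]; have r0 := lt_trans s0 sr.
have -> : r^-1 *: x = (s / r) *: (s^-1 *: x) + (1 - s / r) *: 0.
  rewrite scaler0 addr0 scalerA; congr (_ *: _).
  by rewrite mulrAC divff ?gt_eqF// mul1r.
apply: C_convex => //; apply/andP; split; first by rewrite divr_ge0// ltW.
by rewrite ler_pdivrMr// mul1r ltW.
Qed.

Lemma gauge_ge0 x : 0 <= gauge x.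
Proof. by apply: lb_le_inf => // r [/ltW]. Qed.

(** One inequality is enough: the other one is this one for [a^-1] and [a *: x]. *)
Let gaugeZ_le a x : gauge (a *: x) <= `|a| * gauge x.
Proof.
have [->|a0] := eqVneq a 0.
  rewrite scale0r normr0 mul0r; apply/ler_addgt0Pl => e e0; rewrite addr0.
  by apply: gauge_le => //; rewrite scaler0.
apply/ler_addgt0Pl => e e0; have na : 0 < `|a| by rewrite normr_gt0.
have e1 : 0 < e / `|a| by rewrite divr_gt0.
have : gauge x < gauge x + e / `|a| by rewrite ltrDl.
set r := gauge x + e / `|a| => /gauge_lt Cr.
have r0 : 0 < r by rewrite ltr_wpDl// gauge_ge0.
have -> : e + `|a| * gauge x = `|a| * r.
  by rewrite mulrDr mulrCA divff ?gt_eqF// mulr1 addrC.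
apply: gauge_le; first by rewrite mulr_gt0.
rewrite scalerA invfM.
case: (ler0P a) => ha.
  have -> : (- a)^-1 / r * a = - r^-1.
    by field; rewrite a0 gt_eqF.
  by rewrite scaleNr; exact: C_sym.
by have -> : a^-1 / r * a = r^-1 by field; rewrite a0 gt_eqF.
Qed.

Lemma gauge_seminorm : seminorm gauge.
Proof.
split=> [x y|a x].
  apply/ler_addgt0Pl => e e0.
  pose r := gauge x + e / 2; pose s := gauge y + e / 2.
  have e2 : 0 < e / 2 by rewrite divr_gt0.
  have Cx : C (r^-1 *: x) by apply: gauge_lt; rewrite ltrDl.
  have Cy : C (s^-1 *: y) by apply: gauge_lt; rewrite ltrDl.
  have r0 : 0 < r by rewrite ltr_wpDl// gauge_ge0.
  have s0 : 0 < s by rewrite ltr_wpDl// gauge_ge0.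
  have rs0 : 0 < r + s by rewrite addr_gt0.
  have -> : e + (gauge x + gauge y) = r + s by rewrite /r /s; field.
  apply: gauge_le => //.
  have -> : (r + s)^-1 *: (x + y) =
      (r / (r + s)) *: (r^-1 *: x) + (1 - r / (r + s)) *: (s^-1 *: y).
    rewrite scalerDr !scalerA; congr (_ *: _ + _ *: _).
      by field; rewrite !gt_eqF.
    by field; rewrite !gt_eqF.
  apply: C_convex => //; apply/andP; split; first by rewrite divr_ge0// ltW.
  by rewrite ler_pdivrMr// mul1r lerDl ltW.
apply/eqP; rewrite eq_le gaugeZ_le /=.
have [->|a0] := eqVneq a 0; first by rewrite normr0 mul0r gauge_ge0.
have := gaugeZ_le a^-1 (a *: x); rewrite scalerA mulVf// scale1r normfV.
by rewrite ler_pdivlMl ?normr_gt0.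
Qed.

End Gauge.

Section TvsSeminorms.
Context {R : realType} {X : tvsType R}.

(** Local convexity provides a convex neighbourhood [B] of 0 that need not be symmetric. The gauge
    of [C], the intersection of [B] and [-B], is a seminorm, and it is continuous because [C] is a
    neighbourhood of 0. *)
Lemma lcs_tvs : lcs X.
Proof.
move=> x A Ax.
have A0 : nbhs (0 : X) [set v | A (v + x)].
  have := @add_continuous X (0, x);
    rewrite /continuous_at /= add0r => /(_ _ Ax).
  move=> [[B B'] [/= B0 Bx]] BA; apply: filterS B0 => v Bv.
  by apply: (BA (v, x)); split=> //=; exact: nbhs_singleton Bx.
have [Bs Bconv [Bo Bb]] := @locally_convex R X.
have [B [BB B0] BA] := Bb 0 _ A0.
pose C := [set v | B v /\ B (- v)].
have nB : nbhs 0 B by apply: open_nbhs_nbhs; split => //; exact: Bo.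
have nC : nbhs 0 C.
  apply: filterI => //; have := @opp_continuous X 0.
  by rewrite /continuous_at oppr0; exact.
have sc v (r : R) : nbhs (r *: v) C -> \forall s \near r, C (s *: v).
  move=> Cr; have := @scale_continuous R X (r, v).
  rewrite /continuous_at /= => /(_ _ Cr)[[D D'] [/= Dr Dv]] DC.
  by apply: filterS Dr => s Ds; apply: (DC (s, v)); split=> //=;
    exact: nbhs_singleton Dv.
have Ccv u v (k : R) : C u -> C v -> 0 <= k <= 1 -> C (k *: u + (1 - k) *: v).
  move=> [Bu Bu'] [Bv Bv'] /andP[k0 k1].
  have cv w w' : B w -> B w' -> B (k *: w + (1 - k) *: w').
    move=> Bw Bw'; apply: set_mem.
    exact: (Bconv B (mem_set BB) w w' (Itv01 k0 k1) (mem_set Bw) (mem_set Bw')).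
  by split; [exact: cv|rewrite opprD -!scalerN; exact: cv].
have Csym v : C v -> C (- v) by move=> [? ?]; split; rewrite ?opprK.
have Cabs v : exists2 r : R, 0 < r & C (r^-1 *: v).
  have : \forall s \near (0 : R), C (s *: v) by apply: sc; rewrite scale0r.
  move=> /nbhs_ballP[e /= e0 eC]; exists (e / 2)^-1.
    by rewrite invr_gt0 divr_gt0.
  apply: eC; rewrite /ball /= sub0r normrN invrK gtr0_norm ?divr_gt0//.
  by rewrite ltr_pdivrMr// ltr_pMr// ltr1n.
have sg := gauge_seminorm Ccv Csym Cabs.
exists (gauge C); first split=> // y e e0.
  (* [gauge_le] yields a bound that is not strict, hence the half. *)
  have e2 : 0 < e / 2 by rewrite divr_gt0.
  have cont : {for y, continuous (fun z => (e / 2)^-1 *: (z - y))}.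
    apply: (@continuous_comp _ _ _ (fun z => ((e / 2)^-1, z - y) : R^o * X)
      (fun z : R^o * X => z.1 *: z.2)); last exact: scale_continuous.
    apply: (@cvg_pair _ _ _ _ (nbhs ((e / 2)^-1 : R^o))); first exact: cvg_cst.
    apply: (@continuous_comp _ _ _ (fun z => (z, y) : X * X)
      (fun z : X * X => z.1 - z.2)); last exact: sub_continuous.
    by apply: cvg_pair; [exact: cvg_id|exact: cvg_cst].
  have : nbhs ((e / 2)^-1 *: (y - y)) C by rewrite subrr scaler0.
  move=> /cont h; have {}h : \forall z \near y,
    C ((e / 2)^-1 *: (z - y)) by exact: h.
  apply: filterS h => z /(gauge_le e2) h.
  by apply: le_lt_trans h _; rewrite ltr_pdivrMr// ltr_pMr// ltr1n.
move=> y /(gauge_lt Ccv Cabs); rewrite invr1 scale1r => -[/BA /=].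
by rewrite subrK.
Qed.

Lemma csn_continuous (p : X -> R) : csn p -> continuous p.
Proof.
move=> [sp cp] x; apply/cvgrPdist_lt => e e0.
apply: filterS (cp x e e0) => y; apply: le_lt_trans.
rewrite ler_norml; have := seminorm_split sp x y 0; rewrite !subr0.
by have := seminorm_split sp y x 0; rewrite !subr0 (seminormC sp x) => *; lra.
Qed.

Lemma continuous_csn (p : X -> R) : seminorm p -> continuous p -> csn p.
Proof.
move=> sp cp; split=> // x e e0.
have cont : {for x, continuous (fun z : X => p (z - x))}.
  apply: (@continuous_comp _ _ _ (fun z => z - x) p); last exact: cp.
  apply: (@continuous_comp _ _ _ (fun z => (z, x) : X * X)
    (fun z : X * X => z.1 - z.2)); last exact: sub_continuous.
  by apply: cvg_pair; [exact: cvg_id|exact: cvg_cst].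
have /cvgrPdist_lt/(_ _ e0) := cont.
apply: filterS => y; rewrite subrr (seminorm0 sp) sub0r normrN.
by apply: le_lt_trans; exact: ler_norm.
Qed.

Lemma hausdorff_separated : hausdorff_space X -> separated X.
Proof.
move=> hX x H; apply/esym/hX => A B A0 Bx.
have [p cp pB] := lcs_tvs Bx.
exists 0; split; first exact: nbhs_singleton.
by apply: pB; rewrite sub0r (seminormN (csnS cp)) H.
Qed.

End TvsSeminorms.

(** * Differential calculus in locally convex spaces *)

Section MeanValue.
Context {R : realType}.

(* For [D a b = p (c b - c a - (b - a) l)], this yields the mean value
   inequality without the Hahn-Banach theorem. *)
Lemma local_to_global_bound (D : R -> R -> R) (K : R) :
  (forall a b c, D a c <= D a b + D b c) -> (forall a b, D a b = D b a) ->
  (forall s : R, 0 <= s <= 1 -> \forall r \near s, D s r <= K * `|r - s|) ->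
  D 0 1 <= K.
Proof.
(* The local bound at [s = sup S] shows that [S] contains [s], and, if [s < 1], that [S] contains a
   point beyond [s]. *)
move=> Dt Ds Dl; pose S := [set s | 0 <= s <= 1 /\ D 0 s <= K * s].
have S0 : S 0.
  split; first by rewrite lexx ler01.
  have := nbhs_singleton (Dl 0 _); rewrite subrr normr0 => -> //.
  by rewrite lexx ler01.
have Sub : ubound S 1 by move=> s [/andP[]].
have hS : has_sup S by split; [exists 0|exists 1].
set s := sup S.
have s0 : 0 <= s by apply: ub_le_sup => //; exists 1.
have s1 : s <= 1 by apply: ge_sup => //; exists 0.
have s01 : 0 <= s <= 1 by rewrite s0.
have /nbhs_ballP[e /= e0 eD] := Dl s s01.
have Ss : S s.
  split=> //; have [r [r01 Dr] sr] := sup_adherent e0 hS.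
  have rs : r <= s by apply: ub_le_sup => //; exists 1.
  have /eD : ball s e r by rewrite /ball /=
    ger0_norm ?subr_ge0// ltrBlDl -ltrBlDr.
  rewrite ler0_norm ?subr_le0// opprB => h.
  by have := Dt 0 r s; rewrite (Ds r s); nra.
have [s_eq1|] := eqVneq s 1; first by case: Ss => _; rewrite s_eq1 mulr1.
rewrite neq_lt => /orP[s1'|]; last by rewrite ltNge s1.
pose r := Num.min 1 (s + e / 2).
have e2 : 0 < e / 2 by rewrite divr_gt0.
have sr : s < r by rewrite lt_min s1' ltrDl.
have r1 : r <= 1 by rewrite ge_min lexx.
have re : r <= s + e / 2 by rewrite ge_min lexx orbT.
suff : S r by move=> /(ub_le_sup (ex_intro _ 1 Sub)); rewrite leNgt sr.
split; first by rewrite (le_trans s0 (ltW sr)).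
have /eD : ball s e r.
  by rewrite /ball /= distrC gtr0_norm ?subr_gt0//; lra.
rewrite gtr0_norm ?subr_gt0// => h.
by case: Ss => _; have := Dt 0 s r; nra.
Qed.

Context {X : preTopologicalLmodType R}.

(** Differentiability gives the local bound with slope [e + M]. The vector [l] makes the statement
    serve twice: [l = 0] yields Lipschitz estimates, and a value of the derivative as [l] yields
    differentiability. *)
Lemma mean_value (p : X -> R) (c c' : R -> X) (l : X) (M : R) : csn p ->
  (forall s : R, 0 <= s <= 1 -> (fun t : R => t^-1 *: (c (s + t) - c s)) @ 0^'
    --> c' s) ->
  (forall s : R, 0 <= s <= 1 -> p (c' s - l) <= M) -> p (c 1 - c 0 - l) <= M.
Proof.
move=> cp dc bc; have sp := csnS cp; apply/ler_addgt0Pl => e e0.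
pose D a b := p (c b - c a - (b - a) *: l).
have -> : p (c 1 - c 0 - l) = D 0 1 by rewrite /D subr0 scale1r.
apply: local_to_global_bound => [a b d|a b|s s01].
- rewrite /D; have -> : c d - c a - (d - a) *: l =
      (c b - c a - (b - a) *: l) + (c d - c b - (d - b) *: l).
    rewrite addrACA -opprD -scalerDl; congr (_ - _ *: _).
      by rewrite addrC addrA subrK.
    by ring.
  exact: seminormD.
- by rewrite /D -(seminormN sp) opprD opprB opprK -scaleNr opprB.
- have /nbhs_ballP[d /= d0 dh] := cvg_csn (dc s s01) cp e0.
  apply/nbhs_ballP; exists d => //= r rd.
  have [->|rs] := eqVneq r s.
    by rewrite /D !subrr scale0r subr0 (seminorm0 sp) normr0 mulr0.
  have rs0 : r - s != 0 by rewrite subr_eq0.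
  have := dh (r - s); rewrite /ball /= sub0r normrN distrC => /(_ rd rs0).
  rewrite subrKC => h.
  have -> : D s r = `|r - s| * p ((r - s)^-1 *: (c r - c s) - l).
    by rewrite /D -(seminormZ sp) scalerBr scalerA divff// scale1r.
  rewrite mulrC (distrC s) ler_wpM2r//.
  have := seminorm_split sp (c' s) ((r - s)^-1 *: (c r - c s)) l.
  by have := bc s s01; lra.
Qed.

End MeanValue.

(** * Maps of class C^k through tangent maps *)

Section Ck.
Context {R : realType}.
Implicit Types X Y Z F : preTopologicalLmodType R.

(* [C^k] through iterated tangent maps, that is, the derivative is a function
   of the point and the direction: unlike [smooth_on], this formulation is
   visibly stable under composition. *)
Fixpoint ck (F : preTopologicalLmodType R) (k : nat) :
    forall X : preTopologicalLmodType R, set X -> (X -> F) -> Prop :=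
  if k is k'.+1 then fun X U f =>
    (forall x, U x -> {for x, continuous f}) /\
    exists df : X * X -> F,
      (forall x h, U x -> diffquot f h x t @[t --> 0^'] --> df (x, h)) /\
      @ck F k' (X * X)%type (U `*` setT) df
  else fun X U f => forall x, U x -> {for x, continuous f}.

Lemma ck_cont F X k (U : set X) (f : X -> F) x :
  ck k U f -> U x -> {for x, continuous f}.
Proof. by case: k => [|k /= [+ _]]; exact. Qed.

Lemma ckW F k : forall X (U : set X) (f : X -> F), ck k.+1 U f -> ck k U f.
Proof.
elim: k => [|k ih] X U f [cf [df [ddf cdf]]] //.
by split=> //; exists df; split=> //; apply: ih.
Qed.

Lemma ck_sub F k : forall X (U W : set X) (f : X -> F), W `<=` U ->
  ck k U f -> ck k W f.
Proof.
elim: k => [|k ih] X U W f WU /=; first by move=> cf x /WU; exact: cf.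
move=> [cf [df [ddf cdf]]]; split; first by move=> x /WU; exact: cf.
exists df; split; first by move=> x h /WU; exact: ddf.
by apply: ih cdf => -[x h] [/= /WU].
Qed.

Lemma open_setXT X Y (U : set X) : open U -> open (U `*` [set: Y]).
Proof.
move=> oU; rewrite openE => -[x y] [/= Ux _].
exists (U, setT) => //=; split; first exact: open_nbhs_nbhs.
exact: filterT.
Qed.

Lemma open_setX X Y (U : set X) (W : set Y) :
  open U -> open W -> open (U `*` W).
Proof.
move=> oU oW; rewrite openE => -[x y] [/= Ux Wy].
by exists (U, W) => //=; split; exact: open_nbhs_nbhs.
Qed.

Lemma nbhs0_scale (t : R) : t != 0 -> (fun r : R => r * t) @ 0^' --> 0^'.
Proof.
move=> t0 A /nbhs_ballP[e /= e0 eA]; apply/nbhs_ballP.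
exists (e / `|t|) => /=; first by rewrite divr_gt0// normr_gt0.
move=> r; rewrite /ball /= sub0r normrN ltr_pdivlMr ?normr_gt0// -normrM =>
  rt r0.
by apply: eA; [rewrite /ball /= sub0r normrN|rewrite mulf_neq0].
Qed.

Lemma near_line X (U : set X) h x : lcs X -> nbhs x U ->
  \forall t \near (0 : R), U (x + t *: h).
Proof.
move=> lX /lX[q cq qU]; have q0 := seminorm_ge0 (csnS cq) h.
apply/nbhs_ballP; exists (q h + 1)^-1 => /=; first by rewrite invr_gt0 ltr_wpDl.
move=> t; rewrite /ball /= sub0r normrN => th.
apply: qU; rewrite addrAC subrr add0r (seminormZ (csnS cq)).
move: th; rewrite -[ltRHS]mul1r ltr_pdivlMr ?ltr_wpDl// => th.
by have := normr_ge0 t; nra.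
Qed.

Lemma diffquot_ext X F (f g : X -> F) (U : set X) h x (l : F) : lcs X ->
  open U -> U x -> (forall y, U y -> f y = g y) ->
  diffquot f h x t @[t --> 0^'] --> l -> diffquot g h x t @[t --> 0^'] --> l.
Proof.
move=> lX oU Ux fg; apply: cvg_trans; apply: near_eq_cvg; apply: nbhs_dnbhs.
apply: filterS (near_line h lX (open_nbhs_nbhs (conj oU Ux))) => t Ut.
by rewrite /diffquot !fg.
Qed.

Lemma ck_ext F k : forall X (U : set X) (f g : X -> F), lcs X -> open U ->
  (forall x, U x -> f x = g x) -> ck k U f -> ck k U g.
Proof.
have c X (U : set X) (f g : X -> F) x : open U -> U x ->
    (forall x, U x -> f x = g x) -> {for x, continuous f} ->
      {for x, continuous g}.
  move=> oU Ux fg; rewrite /prop_for /continuous_at -fg//; apply: cvg_trans.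
  apply: near_eq_cvg; apply: filterS (open_nbhs_nbhs (conj oU Ux)) => y Uy.
  by rewrite fg.
case: k => [|k] X U f g lX oU fg.
  by move=> cf x Ux; exact: (c _ U f g x oU Ux fg (cf x Ux)).
move=> [cf [df [ddf cdf]]]; split.
  by move=> x Ux; exact: (c _ U f g x oU Ux fg (cf x Ux)).
exists df; split=> // x h Ux; exact: diffquot_ext lX oU Ux fg (@ddf x h Ux).
Qed.

(** Strict differentiability: base point and direction vary along with [t]. It is the mean value
    inequality for [s |-> f (y + s t k)], whose derivative [t df (y + s t k, k)] is close to
    [t df (x, h)] by joint continuity of [df]. *)
Lemma strong_diff X F (U : set X) (f : X -> F) (df : X * X -> F) x h p (e : R) :
  lcs X -> lcs F -> open U -> U x ->
  (forall x h, U x -> diffquot f h x t @[t --> 0^'] --> df (x, h)) ->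
  {for (x, h), continuous df} -> csn p -> 0 < e ->
  exists q, csn q /\ exists2 d, 0 < d & forall y k t,
    q (y - x) < d -> q (k - h) < d -> `|t| < d ->
    p (f (y + t *: k) - f y - t *: df (x, h)) <= e * `|t|.
Proof.
move=> lX lF oU Ux ddf cdf cp e0; have sp := csnS cp.
have [[A C] /= [/lX[q1 cq1 qA] /lX[q2 cq2 qC]] AC] :=
  cdf _ (csn_ball cp (df (x, h)) e0).
have [q3 cq3 qU] := lX _ _ (open_nbhs_nbhs (conj oU Ux)).
pose q y := q1 y + (q2 y + q3 y).
have cq : csn q by apply: csnD => //; apply: csnD.
have sq := csnS cq; have qh0 := seminorm_ge0 sq h.
have q1q y : q1 y <= q y by rewrite lerDl addr_ge0// seminorm_ge0//;
  exact: csnS.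
have q2q y : q2 y <= q y.
  by rewrite /q addrCA lerDl addr_ge0// seminorm_ge0//; exact: csnS.
have q3q y : q3 y <= q y.
  by rewrite /q addrA lerDr addr_ge0// seminorm_ge0//; exact: csnS.
(* With this radius [q (y - x)] and [|t| q k] are both at most 1/2, the second one strictly below,
   so the segment from [y] to [y + t k] stays in the unit ball of [q] around [x]. *)
exists q; split=> //; exists (2^-1 / (q h + 1)).
  by rewrite divr_gt0// ltr_wpDl.
move=> y k t.
have d2 : 2^-1 / (q h + 1) <= 2^-1 by rewrite ler_pdivrMr ?ltr_wpDl//; lra.
move=> yx kh; rewrite ltr_pdivlMr ?ltr_wpDl// => td.
have kh1 : q k <= q h + 1.
  by have := seminorm_split sq h k 0; rewrite !subr0; lra.
have seg s : 0 <= s <= 1 -> q (y + (s * t) *: k - x) < 1.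
  move=> /andP[s0 s1]; rewrite addrAC; apply: le_lt_trans (seminormD sq _ _) _.
  rewrite (seminormZ sq) normrM (ger0_norm s0).
  have : s * `|t| * q k <= `|t| * (q h + 1).
    by rewrite ler_pM ?mulr_ge0 ?(seminorm_ge0 sq)// ler_piMl.
  lra.
have [->|t0] := eqVneq t 0.
  by rewrite !scale0r addr0 !subrr (seminorm0 sp) normr0 mulr0.
pose c s := f (y + (s * t) *: k).
have -> : f (y + t *: k) - f y = c 1 - c 0.
  by rewrite /c mul1r mul0r scale0r addr0.
apply: (mean_value (c' := fun s => t *: df (y + (s * t) *: k, k)) cp).
  move=> s s01.
  have Us : U (y + (s * t) *: k).
    by apply: qU; apply: le_lt_trans (q3q _) _; exact: seg.
  have dd := cvg_comp _ _ (nbhs0_scale t0) (ddf _ k Us).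
  have : (fun r : R => t *: diffquot f k (y + (s * t) *: k) (r * t)) @ 0^' -->
      t *: df (y + (s * t) *: k, k).
    exact: lcs_cvgZr.
  apply: cvg_trans; apply: near_eq_cvg.
  apply: filterS (nbhs_dnbhs_neq (0 : R)) => r r0 /=.
  rewrite /diffquot scalerA /c mulrDl scalerDl addrA; congr (_ *: _).
  by rewrite invfM mulrCA divff// mulr1.
move=> s s01; rewrite -scalerBr (seminormZ sp) mulrC ler_wpM2r//.
have hA : A (y + (s * t) *: k) by apply: qA;
  apply: le_lt_trans (q1q _) (seg s s01).
have hC : C k by apply: qC; apply: le_lt_trans (q2q _) _; lra.
exact/ltW/(AC (y + (s * t) *: k, k)).
Qed.

Section C1.
Context X F (U : set X) (f : X -> F) (df : X * X -> F).
Hypotheses (lX : lcs X) (lF : lcs F) (sF : separated F) (oU : open U).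
Hypothesis ddf :
  forall x h, U x -> diffquot f h x t @[t --> 0^'] --> df (x, h).
Hypothesis cdf : forall x h, U x -> {for (x, h), continuous df}.

(** The chain rule needs the varying direction, the additivity of the derivative the varying base
    point. *)
Lemma diff_curve (T : Type) (fl : set_system T) {ff : Filter fl}
    (y k : T -> X) (t : T -> R) x h :
  U x -> y @ fl --> x -> k @ fl --> h -> t @ fl --> 0^' ->
  (fun s => (t s)^-1 *: (f (y s + t s *: k s) - f (y s))) @ fl --> df (x, h).
Proof.
move=> Ux yx kh t0; apply/(lcs_cvgP _ _ lF) => p e cp e0.
have e2 : 0 < e / 2 by rewrite divr_gt0.
have [q [cq [d d0 H]]] := strong_diff lX lF oU Ux ddf (@cdf _ h Ux) cp e2.
have td : \forall s \near fl, t s != 0 /\ `|t s| < d.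
  apply: (t0 [set r : R | r != 0 /\ `|r| < d]).
  have rd : \forall r \near (0 : R)^', `|r| < d.
    apply: nbhs_dnbhs; apply/nbhs_ballP; exists d => //= s.
    by rewrite /ball /= sub0r normrN.
  by apply: filterS2 (nbhs_dnbhs_neq (0 : R)) rd => r r0 rd; split.
near=> s; have [ts0 tsd] : t s != 0 /\ `|t s| < d by near: s.
have := H (y s) (k s) (t s); have -> : f (y s + t s *: k s) - f (y s) - t s *:
  df (x, h)
  = t s *: ((t s)^-1 *: (f (y s + t s *: k s) - f (y s)) - df (x, h)).
  by rewrite scalerBr scalerA divff// scale1r.
rewrite (seminormZ (csnS cp)) mulrC ler_pM2r ?normr_gt0// => le2.
apply: le_lt_trans (le2 _ _ tsd) _.
- by near: s; exact: (cvg_csn yx cq d0).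
- by near: s; exact: (cvg_csn kh cq d0).
- by rewrite ltr_pdivrMr// ltr_pMr// ltr1n.
Unshelve. all: by end_near. Qed.

Lemma diff_curve0 (k : R -> X) x h : U x -> k @ 0^' --> h ->
  (fun t => t^-1 *: (f (x + t *: k t) - f x)) @ 0^' --> df (x, h).
Proof. by move=> Ux kh; apply: (diff_curve (t := id)) => //; exact: cvg_cst.
  Qed.

Lemma diff_scale x a h : U x -> df (x, a *: h) = a *: df (x, h).
Proof.
move=> Ux; have [->|a0] := eqVneq a 0.
  rewrite !scale0r; apply: (lcs_cvg_unique sF (@ddf x 0 Ux)).
  rewrite (_ : diffquot _ _ _ = cst 0); first exact: cvg_cst.
  by apply/funext => t; rewrite /diffquot scaler0 addr0 subrr scaler0.
apply: (lcs_cvg_unique sF (@ddf x (a *: h) Ux)).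
have : (fun r : R => a *: diffquot f h x (r * a)) @ 0^' --> a *: df (x, h).
  by apply: lcs_cvgZr => //; exact: cvg_comp _ _ (nbhs0_scale a0) (@ddf x h Ux).
apply: cvg_trans; apply: near_eq_cvg.
apply: filterS (nbhs_dnbhs_neq (0 : R)) => t t0 /=.
by rewrite /diffquot !scalerA invfM mulrCA divff// mulr1.
Qed.

(** The step along [a h + h'] is made first along [h'] and then along [a h] from the moved base
    point, to which [diff_curve] applies. *)
Lemma diff_linear x : U x -> linear (fun h => df (x, h)).
Proof.
move=> Ux a h h'; rewrite -diff_scale//.
apply: (lcs_cvg_unique sF (@ddf x (a *: h + h') Ux)).
have id0 : (fun t : R => t) @ 0^' --> (0 : R) by exact: cvg_within.
have ca : (fun t : R => x + t *: h') @ 0^' --> x.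
  rewrite -[X in _ --> X]addr0 -[X in _ + X](scale0r h').
  apply: lcs_cvgD => //; first exact: cvg_cst.
  by apply: lcs_cvgZ => //; exact: cvg_cst.
have : (fun t : R => t^-1 *: (f (x + t *: h' + t *: (a *: h)) - f
  (x + t *: h')) +
    diffquot f h' x t) @ 0^' --> df (x, a *: h) + df (x, h').
  apply: lcs_cvgD => //; last exact: ddf.
  by apply: diff_curve => //; exact: cvg_cst.
apply: cvg_trans; apply: near_eq_cvg; apply: nearW => t.
rewrite /diffquot -scalerDr addrA subrK; congr (_ *: (f _ - _)).
by rewrite scalerDr addrA addrAC.
Qed.

End C1.

Lemma linear_diffquot X F (L : X -> F) h x : linear L -> lcs F ->
  diffquot L h x t @[t --> 0^'] --> L h.
Proof.
move=> lL lF; have : (fun _ : R => L h) @ 0^' --> L h by exact: cvg_cst.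
apply: cvg_trans; apply: near_eq_cvg.
apply: filterS (nbhs_dnbhs_neq (0 : R)) => t t0 /=.
by rewrite /diffquot [x + _]addrC lL addrK scalerA mulVf// scale1r.
Qed.

Lemma snd_linear X Y : linear (@snd X Y). Proof. by []. Qed.
Lemma linear_comp X Y F (L : Y -> F) (M : X -> Y) : linear L -> linear M ->
  linear (L \o M).
Proof. by move=> lL lM a x y /=; rewrite lM lL. Qed.

Lemma ck_linear F k : lcs F -> forall X (U : set X) (L : X -> F), linear L ->
  continuous L -> ck k U L.
Proof.
move=> lF; elim: k => [|k ih] X U L lL cL /=; first by move=> x _; exact: cL.
split; first by move=> x _; exact: cL.
exists (L \o snd); split=> [x h _|]; first exact: linear_diffquot.
apply: ih; first exact: linear_comp lL (@snd_linear X X).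
by move=> z; apply: continuous_comp; [exact: cvg_snd|exact: cL].
Qed.

Lemma diffquot_cst X F (c : F) h x :
  diffquot (fun _ : X => c) h x t @[t --> 0^'] --> (0 : F).
Proof.
rewrite (_ : diffquot _ _ _ = cst 0); first exact: cvg_cst.
by apply/funext => t; rewrite /diffquot subrr scaler0.
Qed.

Lemma ck_cst F k : forall X (U : set X) (c : F), ck k U (fun _ => c).
Proof.
elim: k => [|k ih] X U c /=; first by move=> x _; exact: cvg_cst.
split; first by move=> x _; exact: cvg_cst.
by exists (fun _ => 0); split; [move=> x h _; exact: diffquot_cst|exact: ih].
Qed.

Lemma ck_pair k Y Z : forall X (U : set X) (f : X -> Y) (g : X -> Z),
  ck k U f -> ck k U g -> ck k U (fun x => (f x, g x) : Y * Z).
Proof.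
elim: k => [|k ih] X U f g.
  by move=> cf cg x Ux; apply: cvg_pair; [exact: cf|exact: cg].
move=> [cf [df [ddf cdf]]] [cg [dg [ddg cdg]]]; split.
  by move=> x Ux; apply: cvg_pair; [exact: cf|exact: cg].
exists (fun z => (df z, dg z)); split; last exact: ih.
by move=> x h Ux; apply: cvg_pair; [exact: ddf|exact: ddg].
Qed.

Lemma ck_fst k Y Z : forall X (U : set X) (f : X -> Y * Z),
  ck k U f -> ck k U (fun x => (f x).1).
Proof.
elim: k => [|k ih] X U f.
  by move=> cf x Ux; apply: continuous_comp; [exact: cf|exact: cvg_fst].
move=> [cf [df [ddf cdf]]]; split.
  by move=> x Ux; apply: continuous_comp; [exact: cf|exact: cvg_fst].
exists (fun z => (df z).1); split; last exact: ih.
move=> x h Ux.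
exact: (cvg_comp (fun t => diffquot f h x t) fst (ddf x h Ux) cvg_fst).
Qed.

Lemma ck_snd k Y Z : forall X (U : set X) (f : X -> Y * Z),
  ck k U f -> ck k U (fun x => (f x).2).
Proof.
elim: k => [|k ih] X U f.
  by move=> cf x Ux; apply: continuous_comp; [exact: cf|exact: cvg_snd].
move=> [cf [df [ddf cdf]]]; split.
  by move=> x Ux; apply: continuous_comp; [exact: cf|exact: cvg_snd].
exists (fun z => (df z).2); split; last exact: ih.
move=> x h Ux.
exact: (cvg_comp (fun t => diffquot f h x t) snd (ddf x h Ux) cvg_snd).
Qed.

(** The derivative [dg (f x, df (x, h))] is again a composition, of maps of class one lower on
    [X * X]; hence the induction on [k] with all spaces general. *)
Lemma ck_comp k : forall X Y F (U : set X) (V : set Y) (f : X -> Y)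
  (g : Y -> F),
  lcs X -> lcs Y -> lcs F -> open U -> open V -> ck k U f -> ck k V g ->
  (forall x, U x -> V (f x)) -> ck k U (fun x => g (f x)).
Proof.
elim: k => [|k ih] X Y F U V f g lX lY lF oU oV.
  move=> cf cg UV x Ux; apply: continuous_comp; first exact: cf.
  by apply: cg; exact: UV.
move=> cf cg UV; have [cf0 [df [ddf cdf]]] := cf;
  have [cg0 [dg [ddg cdg]]] := cg.
split.
  move=> x Ux; apply: continuous_comp; first exact: cf0.
  by apply: cg0; exact: UV.
exists (fun z => dg (f z.1, df z)); split.
  move=> x h Ux; have Vx := UV x Ux.
  (* The difference quotient of the composition is one of [g] in the varying direction
     [diffquot f h x t]. *)
  have : (fun t => t^-1 *: (g (f x + t *: diffquot f h x t) - g (f x))) @ 0^'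
    -->
      dg (f x, df (x, h)).
    apply: (@diff_curve0 _ _ V) => //; last exact: ddf.
    by move=> y k' Vy; apply: (ck_cont cdg).
  apply: cvg_trans; apply: near_eq_cvg.
  apply: filterS (nbhs_dnbhs_neq (0 : R)) => t t0 /=.
  by rewrite {2}/diffquot scalerA divff// scale1r subrKC.
apply: (ih _ _ _ _ (V `*` setT) (fun z => (f z.1, df z)) dg) => //.
- exact: lcs_prod.
- exact: lcs_prod.
- exact: open_setXT.
- exact: open_setXT.
- apply: ck_pair => //.
  apply: (ih _ _ _ _ U fst f) => //.
  + exact: lcs_prod.
  + exact: open_setXT.
  + by apply: ck_linear => // z; exact: cvg_fst.
  + exact: ckW.
  + by move=> z [].
- by move=> [x h] [/= /UV].
Qed.

Lemma ck_add k F X (U : set X) (f g : X -> F) : lcs X -> lcs F -> open U ->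
  ck k U f -> ck k U g -> ck k U (fun x => f x + g x).
Proof.
move=> lX lF oU cf cg.
apply: (ck_comp (V := setT) (f := fun x => (f x, g x)) (g := fun z : F * F =>
  z.1 + z.2)) => //.
- exact: lcs_prod.
- exact: openT.
- exact: ck_pair.
- apply: ck_linear => // [a u v /=|z]; first by rewrite scalerDr addrACA.
  by apply: lcs_cvgD => //; [exact: cvg_fst|exact: cvg_snd].
Qed.

Section Bilinear.
Context X Y F (B : X * Y -> F).
Hypotheses (lX : lcs X) (lY : lcs Y) (lF : lcs F).
Hypotheses (Bl : forall y, linear (fun x => B (x, y)))
  (Br : forall x, linear (fun y => B (x, y))) (cB : continuous B).

(** The derivative of [B] is a sum of two compositions of [B] with continuous linear maps, so [B]
    itself is C^k for all [k] by induction. *)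
Lemma ck_bilinear k Z (U : set Z) (f : Z -> X) (g : Z -> Y) : lcs Z -> open U ->
  ck k U f -> ck k U g -> ck k U (fun z => B (f z, g z)).
Proof.
suff : forall k, ck k setT B.
  move=> cBk lZ oU cf cg.
  apply: (ck_comp (V := setT) (f := fun z => (f z, g z))) => //.
  - exact: lcs_prod.
  - exact: openT.
  - exact: ck_pair.
elim=> [|{}k ih]; first by move=> z _; exact: cB.
split; first by move=> z _; exact: cB.
exists (fun z => B (z.1.1, z.2.2) + B (z.2.1, z.1.2)); split.
  move=> [x y] [x' y'] _ /=.
  have : (fun t : R => B (x, y') + B (x', y) + t *: B (x', y')) @ 0^' -->
      B (x, y') + B (x', y) + 0 *: B (x', y').
    apply: lcs_cvgD => //; first exact: cvg_cst.
    apply: lcs_cvgZ => //; last exact: cvg_cst.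
    exact: cvg_within.
  rewrite scale0r addr0; apply: cvg_trans; apply: near_eq_cvg.
  apply: filterS (nbhs_dnbhs_neq (0 : R)) => t t0 /=.
  have E : (x, y) + t *: (x', y') = (t *: x' + x, t *: y' + y).
    by rewrite addrC; reflexivity.
  rewrite /diffquot E.
  have -> : B (t *: x' + x, t *: y' + y) =
      t *: (t *: B (x', y') + B (x', y)) + (t *: B (x, y') + B (x, y)).
    by rewrite (Bl _ t x' x) (Br x' t y' y) (Br x t y' y).
  rewrite addrA addrK -scalerDr scalerA mulVf// scale1r.
  by rewrite addrC (addrC (B (x, y'))) addrA.
have lXY := lcs_prod lX lY; have lXY2 := lcs_prod lXY lXY.
have oT : open ([set: X * Y] `*` [set: X * Y]) by apply: open_setXT;
  exact: openT.
have cl Z' (L : (X * Y) * (X * Y) -> Z') : lcs Z' -> linear L -> continuous L ->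
    ck k ([set: X * Y] `*` [set: X * Y]) L by move=> lZ' lL cL;
      exact: ck_linear.
apply: ck_add => //.
  apply: (ck_comp (V := setT) (f := fun z => (z.1.1, z.2.2)) (g := B)) => //;
    first exact: openT.
  apply: cl => // z; apply: cvg_pair.
    by apply: continuous_comp; [exact: cvg_fst|exact: cvg_fst].
  by apply: continuous_comp; [exact: cvg_snd|exact: cvg_snd].
apply: (ck_comp (V := setT) (f := fun z => (z.2.1, z.1.2)) (g := B)) => //;
  first exact: openT.
apply: cl => // z; apply: cvg_pair.
  by apply: continuous_comp; [exact: cvg_snd|exact: cvg_fst].
by apply: continuous_comp; [exact: cvg_fst|exact: cvg_snd].
Qed.

End Bilinear.

Lemma diffquot_dir_derive X F (f : X -> F) h x (l : F) : separated F ->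
  diffquot f h x t @[t --> 0^'] --> l -> dir_derive h f x = l.
Proof.
move=> sF fl; rewrite /dir_derive; case: xgetP => [m _ fm|/(_ l)//].
exact: (lcs_cvg_unique sF fm fl).
Qed.

(** The derivatives on the various [W] are given separately; [dir_derive] glues them, as limits in
    [F] are unique. *)
Lemma ck_local F k : separated F -> forall X (U : set X) (f : X -> F), lcs X ->
  (forall x, U x -> exists W, [/\ open W, W x & ck k W f]) -> ck k U f.
Proof.
move=> sF; elim: k => [|k ih] X U f lX H.
  by move=> x /H[W [_ Wx cf]]; exact: cf.
split; first by move=> x /H[W [_ Wx cf]]; exact: (ck_cont cf).
exists (fun z => dir_derive z.2 f z.1);
  split=> [x h /H[W [_ Wx [_ [df [ddf _]]]]]|].
  by rewrite /= (diffquot_dir_derive sF (ddf x h Wx)); exact: ddf.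
apply: ih => [|[x h] [/= /H[W [oW Wx [_ [df [ddf cdf]]]]] _]].
  exact: lcs_prod.
exists (W `*` setT); split=> //; first exact: open_setXT.
apply: ck_ext cdf; first exact: lcs_prod.
  exact: open_setXT.
by move=> [y k'] [/= Wy _]; rewrite (diffquot_dir_derive sF (ddf y k' Wy)).
Qed.

End Ck.

Lemma continuous_pair (S T T' : topologicalType) (f : S -> T) (g : S -> T') x :
  {for x, continuous f} -> {for x, continuous g} ->
  {for x, continuous (fun y => (f y, g y))}.
Proof. by move=> cf cg; exact: cvg_pair. Qed.

Lemma ptws_continuous (I : Type) (X Y : topologicalType)
    (g : Y -> {ptws I -> X}) y :
  (forall i, {for y, continuous (fun z => g z i)}) -> {for y, continuous g}.
Proof.
move=> cg; apply/cvg_sup => i A; rewrite nbhsE => -[B [ [W oO OB] Bt] BA].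
have Oy : nbhs (g y i) W.
  by apply: open_nbhs_nbhs; split=> //; move: Bt; rewrite -OB.
have h : \forall z \near y, W (g z i) by exact: (cg i W Oy).
have : \forall z \near y, A (g z) by apply: filterS h => z Wz; apply: BA;
  rewrite -OB.
exact.
Qed.

Lemma ptws_proj_continuous (I : Type) (X : topologicalType) (i : I) :
  continuous (fun f : {ptws I -> X} => f i).
Proof.
move=> f A fA; have /cvg_sup/(_ i) : (f : {ptws I -> X}) --> f by apply: cvg_id.
apply; move: fA; rewrite !nbhsE => -[W [oO Of] OA].
exists ((fun f => f i) @^-1` W); last by move=> h; exact: OA.
by split=> //; exists W.
Qed.

Fixpoint allP (T : Type) (P : T -> Prop) (s : seq T) : Prop :=
  if s is x :: s' then P x /\ allP P s' else True.

Lemma allP_cat T (P : T -> Prop) s1 s2 :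
  allP P (s1 ++ s2) <-> allP P s1 /\ allP P s2.
Proof. by elim: s1 => [|x s1 ih] /=; rewrite ?ih; tauto. Qed.

Lemma allP_map T T' (P : T' -> Prop) (h : T -> T') s :
  allP P (map h s) <-> allP (fun x => P (h x)) s.
Proof. by elim: s => [|x s1 ih] /=; rewrite ?ih; tauto. Qed.

Lemma allP_imp T (P Q : T -> Prop) s : (forall x, P x -> Q x) ->
  allP P s -> allP Q s.
Proof. by move=> PQ; elim: s => [//|x s ih] [/PQ ? /ih]. Qed.

Lemma allP_nth T (P : T -> Prop) x0 s i : allP P s -> (i < size s)%N ->
  P (nth x0 s i).
Proof. by elim: s i => [//|x s ih] [|i] /= [Px Ps]// is'; exact: ih. Qed.

(** * From C^k for all k to smoothness by iterated directional derivatives *)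

Section Conversion.
Context {R : realType}.
Implicit Types X Y Z P F : preTopologicalLmodType R.

Lemma iter_dir_derive_ext X F (U : set X) hs : lcs X -> open U ->
  forall (f g : X -> F), (forall x, U x -> f x = g x) ->
  forall x, U x -> iter_dir_derive f hs x = iter_dir_derive g hs x.
Proof.
move=> lX oU; elim: hs => [|h hs ih] f g fg x Ux; first exact: fg.
apply: ih => // y Uy; rewrite /dir_derive; congr xget; apply/seteqP; split=> l.
  exact: (diffquot_ext lX oU Uy fg).
by apply: (diffquot_ext lX oU Uy) => z /fg.
Qed.

Lemma ck_dir_derive X F (U : set X) (f : X -> F) k :
  lcs X -> open U -> separated F ->
  ck k.+1 U f -> ck k (U `*` setT) (fun z : X * X => dir_derive z.2 f z.1) /\
  forall x h, U x -> diffquot f h x t @[t --> 0^'] --> dir_derive h f x.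
Proof.
move=> lX oU sF [cf [df [ddf cdf]]].
have E x h : U x -> dir_derive h f x = df (x, h).
  by move=> Ux; exact: diffquot_dir_derive (ddf x h Ux).
split=> [|x h Ux]; last by rewrite E//; exact: ddf.
apply: ck_ext cdf; first exact: lcs_prod.
  exact: open_setXT.
by move=> [x h] [/= Ux _]; rewrite E.
Qed.

Lemma ck_id k X (U : set X) : lcs X -> ck k U id.
Proof. by move=> lX; apply: ck_linear => // x; exact: cvg_id. Qed.

Lemma ck_iter_dir_derive X F (U : set X) (f : X -> F) hs :
  lcs X -> lcs F -> open U -> separated F ->
  (forall k, ck k U f) -> forall k, ck k U (iter_dir_derive f hs).
Proof.
move=> lX lF oU sF; elim: hs f => [//|h hs ih] f cf; apply: ih => k.
apply: (ck_comp (V := U `*` setT) (f := fun x => (x, h))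
  (g := fun z : X * X => dir_derive z.2 f z.1)) => //.
- exact: lcs_prod.
- exact: open_setXT.
- by apply: ck_pair; [exact: ck_id|exact: ck_cst].
- by have [] := ck_dir_derive lX oU sF (cf k.+1).
Qed.

(* In the induction, directions already used become parameters [q y] of [G]. *)
Lemma ck_iter_continuous X F (U : set X) (Y : topologicalType) (a : Y -> X)
    (bs : seq (Y -> X)) y0 : lcs X -> lcs F -> open U -> separated F ->
  forall P (G : X * P -> F) (q : Y -> P), lcs P ->
  ck (size bs) (U `*` setT) G ->
  {for y0, continuous a} -> {for y0, continuous q} ->
  allP (fun b => {for y0, continuous b}) bs -> U (a y0) ->
  {for y0, continuous (fun y =>
    iter_dir_derive (fun x => G (x, q y)) [seq b y | b <- bs] (a y))}.
Proof.
move=> lX lF oU sF; elim: bs => [|b bs ih] P G q lP cG ca cq cbs Ua.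
  apply: (@continuous_comp _ _ _ (fun y => (a y, q y)) G);
    first exact: cvg_pair.
  exact: (ck_cont (x := (a y0, q y0)) cG (conj Ua I)).
case: cbs => cb cbs; have lXP := lcs_prod lX lP.
have oUT : open (U `*` [set: P]) by exact: open_setXT.
have [cdG ddG] := ck_dir_derive lXP oUT sF cG.
pose G' (z : X * (P * X)) := dir_derive (z.2.2, 0) G (z.1, z.2.1).
have cG' : ck (size bs) (U `*` setT) G'.
  apply: (ck_comp (V := (U `*` [set: P]) `*` [set: X * P])
    (f := fun z : X * (P * X) => ((z.1, z.2.1), (z.2.2, 0) : X * P))
    (g := fun z => dir_derive z.2 G z.1)) => //.
  - by apply: lcs_prod => //; exact: lcs_prod.
  - exact: lcs_prod.
  - exact: open_setXT.
  - exact: open_setXT.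
  - apply: ck_linear; first exact: lcs_prod.
      by move=> r u v; congr ((_, _), (_, _)); rewrite /= scaler0 addr0.
    move=> z; apply: continuous_pair; apply: continuous_pair.
    + exact: cvg_fst.
    + by apply: continuous_comp; [exact: cvg_snd|exact: cvg_fst].
    + by apply: continuous_comp; [exact: cvg_snd|exact: cvg_snd].
    + exact: cvg_cst.
have cq' : {for y0, continuous (fun y => (q y, b y))} by exact: cvg_pair.
have E y : U (a y) -> iter_dir_derive (fun x => G' (x, (q y, b y)))
  [seq b y | b <- bs] (a y) =
    iter_dir_derive (fun x => G (x, q y)) [seq b y | b <- b :: bs] (a y).
  move=> Uy; apply: (iter_dir_derive_ext _ lX oU) => // x Ux.
  apply/esym/(diffquot_dir_derive sF).
  have := ddG (x, q y) (b y, 0) (conj Ux I); apply: cvg_trans;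
    apply: near_eq_cvg.
  apply: nearW => t; rewrite /diffquot.
  by congr (_ *: (G _ - _)); congr pair; rewrite /= scaler0 addr0.
have := ih _ G' _ (lcs_prod lP lX) cG' ca cq' cbs Ua.
rewrite /prop_for /continuous_at (E y0 Ua); apply: cvg_trans.
apply: near_eq_cvg.
have h : \forall y \near y0, U (a y)
  by exact: (ca U (open_nbhs_nbhs (conj oU Ua))).
by apply: filterS h => y Uy; rewrite -E.
Qed.

Lemma ck_smooth_on X F (U : set X) (f : X -> F) : lcs X -> lcs F -> open U ->
  separated F -> (forall k, ck k U f) -> smooth_on U f.
Proof.
move=> lX lF oU sF cf; split=> [hs h x Ux|j x h Ux].
  have [_ /(_ x h Ux) dd] := ck_dir_derive lX oU sF
    (ck_iter_dir_derive hs lX lF oU sF cf 1).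
  by exists (dir_derive h (iter_dir_derive f hs) x).
(* On [Y] each direction is itself a continuous function of the point, so [ck_iter_continuous]
   applies, with a dummy parameter that is constantly 0. *)
pose Y := (X * {ptws 'I_j -> X})%type.
pose bs : seq (Y -> X) := [seq (fun p : Y => p.2 i) | i <- enum 'I_j].
have cbs : allP (fun b => {for (x, h), continuous b}) bs.
  rewrite /bs allP_map; elim: (enum _) => [//|i s ih] /=; split=> //.
  apply: (@continuous_comp _ _ _ snd (fun g : {ptws 'I_j -> X} => g i)).
    exact: cvg_snd.
  exact: ptws_proj_continuous.
have cG : ck (size bs) (U `*` setT) (fun z : X * X => f z.1).
  apply: (ck_comp (V := U) (f := fst) (g := f)) => //; first exact: lcs_prod.
  - exact: open_setXT.
  - by apply: ck_linear => // z; exact: cvg_fst.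
  - by move=> z [].
have HE : (fun p : Y => iter_dir_derive (fun x => f x) [seq b p | b <- bs] p.1)
  =
    (fun p : Y => iter_dir_derive f (codom p.2) p.1).
  by apply/funext => p; rewrite codomE /bs -map_comp.
have c1 : {for (x, h), continuous (fst : Y -> X)} by exact: cvg_fst.
have c2 : {for (x, h), continuous (fun _ : Y => (0 : X))} by exact: cvg_cst.
have := @ck_iter_continuous X F U Y fst bs (x, h) lX lF oU sF _ _ (fun _ => 0)
  lX cG
  c1 c2 cbs Ux.
by rewrite HE.
Qed.

End Conversion.

Lemma const_continuous (S T : topologicalType) (c : T) (x : S) :
  {for x, continuous (fun _ : S => c)}.
Proof. exact: cvg_cst. Qed.

Lemma line_continuous (R : realType) (Z : preTopologicalLmodType R) (z k : Z) :
  lcs Z -> continuous (fun t : R => z + t *: k).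
Proof.
move=> lZ t0.
have h0 : (fun t : R => t) @ t0 --> t0 by move=> S.
have h1 : (fun _ : R => k) @ t0 --> k by exact: cvg_cst.
have h : (fun t : R => t *: k) @ t0 --> t0 *: k by exact: lcs_cvgZ lZ h0 h1.
have h' : (fun _ : R => z) @ t0 --> z by exact: cvg_cst.
exact: lcs_cvgD.
Qed.

(** * From iterated directional derivatives to C^k for all k *)

Section SmoothCk.
Context {R : realType} {X F : preTopologicalLmodType R}.
Context (U : set X) (f : X -> F).
Hypotheses (lX : lcs X) (lF : lcs F) (sF : separated F) (oU : open U).
Hypothesis sf : smooth_on U f.

Local Notation Df hs := (iter_dir_derive f hs).

(** The form in which the continuity clause of [smooth_on] is used: directions that are continuous
    functions combine to one map into the product space. *)
Lemma smooth_on_continuous (Y : topologicalType) (a : Y -> X)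
    (bs : seq (Y -> X)) y0 :
  {for y0, continuous a} -> allP (fun b => {for y0, continuous b}) bs ->
    U (a y0) ->
  {for y0, continuous (fun y => iter_dir_derive f [seq b y | b <- bs] (a y))}.
Proof.
move=> ca cbs Ua; pose j := size bs.
pose g (y : Y) : {ptws 'I_j -> X} := fun i => nth a bs i y.
have E y : [seq b y | b <- bs] = codom (g y).
  apply: (@eq_from_nth _ 0) => [|i];
    rewrite size_map ?size_codom ?card_ord// => ij.
  rewrite (nth_map a)// codomE (nth_map (Ordinal ij)) ?size_enum_ord//.
  by rewrite /g (nth_enum_ord _ ij).
have cg : {for y0, continuous g}.
  by apply: ptws_continuous => i; apply: (allP_nth a cbs).
have [_ /(_ j (a y0) (g y0) Ua) cf] := sf.
have HE : (fun y => iter_dir_derive f [seq b y | b <- bs] (a y)) =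
    (fun y => iter_dir_derive f (codom (g y)) (a y)).
  by apply/funext => y; rewrite E.
rewrite HE; apply: (@continuous_comp Y _ _ (fun y => (a y, g y))
  (fun p : X * {ptws 'I_j -> X} => iter_dir_derive f (codom p.2) p.1)) => //.
exact: continuous_pair.
Qed.

Lemma smooth_on_diffquot hs h x : U x ->
  diffquot (Df hs) h x t @[t --> 0^'] --> dir_derive h (Df hs) x.
Proof.
move=> Ux; have [/(_ hs h x Ux)[l fl] _] := sf.
by rewrite (diffquot_dir_derive sF fl).
Qed.

Lemma iter_dir_derive_cat hs1 hs2 :
  Df (hs1 ++ hs2) = iter_dir_derive (Df hs1) hs2.
Proof. by rewrite /iter_dir_derive foldl_cat. Qed.

(** If the slot is the last one, this is the linearity of a single derivative. The later directions
    then differentiate an identity that holds on all of [U]. *)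
Lemma iter_dir_derive_slot a h h' hs1 hs2 x : U x ->
  Df (hs1 ++ (a *: h + h') :: hs2) x =
  a *: Df (hs1 ++ h :: hs2) x + Df (hs1 ++ h' :: hs2) x.
Proof.
elim/last_ind: hs2 x => [|hs2 k ih] x Ux.
  rewrite !iter_dir_derive_cat /=.
  apply: (diff_linear (df := fun z => dir_derive z.2 (Df hs1) z.1) lX lF sF oU)
    => //.
    by move=> y k Uy /=; exact: smooth_on_diffquot.
  move=> y k Uy.
  pose bs : seq (X * X -> X) := rcons [seq (fun _ => b) | b <- hs1] snd.
  have E (z : X * X) : dir_derive z.2 (Df hs1) z.1 = Df [seq b z | b <- bs] z.1.
    rewrite /bs map_rcons -map_comp /iter_dir_derive foldl_rcons /=.
    by rewrite (_ : [seq _ | i <- hs1] = hs1) ?map_id.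
  have HE : (fun z => dir_derive z.2 (Df hs1) z.1) =
    (fun z : X * X => Df [seq b z | b <- bs] z.1) by apply/funext => z.
  rewrite HE; apply: smooth_on_continuous => //; first exact: cvg_fst.
  rewrite /bs -cats1 allP_cat; split; last by split=> //; exact: cvg_snd.
  by rewrite allP_map; elim: (hs1) => //= b s ih; split=> //;
    exact: const_continuous.
rewrite -!rcons_cons -!rcons_cat -!cats1 !(iter_dir_derive_cat _ [:: k]) /=.
apply: (diffquot_dir_derive sF).
have : (fun t => a *: diffquot (Df (hs1 ++ h :: hs2)) k x t +
   diffquot (Df (hs1 ++ h' :: hs2)) k x t) @ 0^' -->
   a *: dir_derive k (Df (hs1 ++ h :: hs2)) x +
     dir_derive k (Df (hs1 ++ h' :: hs2)) x.
  apply: lcs_cvgD => //; last exact: smooth_on_diffquot.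
  by apply: lcs_cvgZr => //; exact: smooth_on_diffquot.
apply: cvg_trans; apply: near_eq_cvg; apply: nbhs_dnbhs.
apply: filterS (near_line k lX (open_nbhs_nbhs (conj oU Ux))) => t Ut.
rewrite /diffquot !ih// scalerA mulrC -scalerA -scalerDr scalerBr opprD.
by rewrite addrACA.
Qed.

Definition lin_cont (Z : preTopologicalLmodType R) (b : Z -> X) := linear b /\
  continuous b.

(* The part of the derivative of [z |-> d^m f(A z)(b_1 z, ..., b_m z)] that
   comes from the linear arguments [b_i]; [pre] collects those already done. *)
Fixpoint slots (Z : preTopologicalLmodType R) (A : Z -> X)
  (pre bs : seq (Z -> X))
    (z : Z * Z) : F :=
  if bs is b :: bs' then
    Df ([seq b' z.1 | b' <- pre] ++ b z.2 :: [seq b' z.1 | b' <- bs']) (A z.1) +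
    slots A (rcons pre b) bs' z
  else 0.

(** The slots move one at a time. As [b (z + t k) = t b k + b z], linearity in the slot makes each
    difference exactly [t] times a term continuous in [t], and continuity of the iterated derivative
    gives the limit. *)
Lemma slots_cvg (Z : preTopologicalLmodType R) (A : Z -> X)
  (bs pre : seq (Z -> X)) z k :
  lcs Z ->
  lin_cont A -> allP (@lin_cont Z) pre -> allP (@lin_cont Z) bs -> U (A z) ->
  (fun t => t^-1 *: (Df ([seq b (z + t *: k) | b <- pre] ++
    [seq b (z + t *: k) | b <- bs])
      (A (z + t *: k)) -
    Df ([seq b (z + t *: k) | b <- pre] ++ [seq b z | b <- bs])
      (A (z + t *: k)))) @ 0^' -->
  slots A pre bs (z, k).
Proof.
move=> lZ [lA cA] cpre; elim: bs pre cpre => [|b bs ih] pre cpre cbs UA.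
  have : (fun _ : R => 0 : F) @ 0^' --> (0 : F) by exact: cvg_cst.
  apply: cvg_trans; apply: near_eq_cvg; apply: nearW => t.
  by rewrite subrr scaler0.
have [[lb cb] cbs'] := cbs.
have cline (g : Z -> X) : continuous g ->
  {for (0 : R), continuous (fun t : R => g (z + t *: k))}.
  move=> cg; apply: (@continuous_comp _ _ _ (fun t : R => z + t *: k) g);
    last exact: cg.
  exact: line_continuous.
have crpre : allP (@lin_cont Z) (rcons pre b) by rewrite -cats1 allP_cat /=.
have ih' := ih (rcons pre b) crpre cbs' UA; rewrite /= addrC.
pose g (t : R) := Df ([seq b' (z + t *: k) | b' <- pre] ++
  b k :: [seq b' z | b' <- bs]) (A (z + t *: k)).
have cg : {for 0, continuous g}.
  pose fs : seq (R -> X) := [seq (fun t : R => b' (z + t *: k)) | b' <- pre] ++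
    (fun=> b k) :: [seq (fun=> b' z) | b' <- bs].
  have E t : [seq b' t | b' <- fs] = [seq b' (z + t *: k) | b' <- pre] ++
    b k :: [seq b' z | b' <- bs].
    by rewrite /fs map_cat /= -!map_comp.
  have HE : g = (fun t => Df [seq b' t | b' <- fs] (A (z + t *: k))).
    by apply/funext => t; rewrite E.
  rewrite HE; apply: smooth_on_continuous.
  - exact: cline.
  - rewrite allP_cat; split; last first.
      split; first exact: const_continuous.
      by rewrite allP_map; elim: (bs) => //= ? ? ?; split=> //;
        exact: const_continuous.
    by rewrite allP_map; apply: allP_imp cpre => b' [_ /cline].
  - by rewrite scale0r addr0.
have cg0 : g @ 0^' --> Df ([seq b' z | b' <- pre] ++
  b k :: [seq b' z | b' <- bs]) (A z).
  have -> : Df ([seq b' z | b' <- pre] ++ b k :: [seq b' z | b' <- bs]) (A z) =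
    g 0.
    by rewrite /g scale0r addr0.
  exact: cvg_trans (cvg_app _ (@nbhs_dnbhs _ _)) cg.
have UA' : \forall t \near (0 : R)^', U (A (z + t *: k)).
  apply: nbhs_dnbhs.
  have hU : nbhs (A (z + 0 *: k)) U.
    by rewrite scale0r addr0; exact: open_nbhs_nbhs (conj oU UA).
  exact: (cline _ cA U hU).
have := @lcs_cvgD R F R (0 : R)^' (dnbhs_filter _) _ _ _ _ lF ih' cg0.
apply: cvg_trans; apply: near_eq_cvg.
apply: filterS2 (nbhs_dnbhs_neq (0 : R)) UA' => t t0 UAt.
rewrite /= -cats1 !map_cat /= -!catA /=.
have -> : b (z + t *: k) = t *: b k + b z by rewrite addrC lb.
rewrite (iter_dir_derive_slot t (b k) (b z) [seq b0 (z + t *: k) | b0 <- pre]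
  [seq b0 z | b0 <- bs] UAt) -/(g t) opprD addrCA scalerDr scalerN scalerA.
by rewrite mulVf// scale1r addrAC addNr add0r.
Qed.

(** The class of functions [z |-> d^m f(A z)(b_1 z, ..., b_m z)] is general enough for induction:
    its derivative is a sum of such functions on [Z * Z], obtained by moving one slot or by
    appending [A] as a new direction. *)
Lemma ck_term k : forall (Z : preTopologicalLmodType R) (A : Z -> X)
  (bs : seq (Z -> X)), lcs Z ->
  lin_cont A -> allP (@lin_cont Z) bs ->
  ck k (A @^-1` U) (fun z => Df [seq b z | b <- bs] (A z)).
Proof.
elim: k => [|k ih] Z A bs lZ cA cbs.
  move=> z UA; apply: smooth_on_continuous => //; first exact: cA.2.
  by apply: allP_imp cbs => b [_ cb]; exact: cb.
have oA : open (A @^-1` U).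
  by move/continuousP: (cA.2); apply.
split.
  move=> z UA; apply: smooth_on_continuous => //; first exact: cA.2.
  by apply: allP_imp cbs => b [_ cb]; exact: cb.
have lc1 (b : Z -> X) : lin_cont b -> lin_cont (fun z : Z * Z => b z.1).
  move=> [lb cb]; split; first by move=> a u v; rewrite /= lb.
  by move=> z; apply: continuous_comp; [exact: cvg_fst|exact: cb].
have lc2 (b : Z -> X) : lin_cont b -> lin_cont (fun z : Z * Z => b z.2).
  move=> [lb cb]; split; first by move=> a u v; rewrite /= lb.
  by move=> z; apply: continuous_comp; [exact: cvg_snd|exact: cb].
have lZZ := lcs_prod lZ lZ.
have oAZ : open ((A @^-1` U) `*` [set: Z]) by exact: open_setXT.
exists (fun z => slots A [::] bs z +
  Df [seq b z | b <- rcons [seq (fun z : Z * Z => b z.1) | b <- bs]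
    (fun z => A z.2)] (A z.1)).
split.
  move=> z h UA.
  have s := @slots_cvg _ A bs [::] z h lZ cA I cbs UA.
  have d := @smooth_on_diffquot [seq b z | b <- bs] (A h) (A z) UA.
  have E : dir_derive (A h) (Df [seq b z | b <- bs]) (A z) =
      Df [seq b (z, h) | b <- rcons [seq (fun z : Z * Z => b z.1) | b <- bs]
        (fun z => A z.2)] (A z).
    by rewrite map_rcons -map_comp /iter_dir_derive foldl_rcons.
  rewrite E in d; have := @lcs_cvgD R F R (0 : R)^' (dnbhs_filter _) _ _ _ _ lF
    s d.
  apply: cvg_trans; apply: near_eq_cvg; apply: nearW => t /=.
  have Ae : A z + t *: A h = A (z + t *: h) by rewrite addrC -cA.1 addrC.
  by rewrite /diffquot Ae -scalerDr addrA subrK.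
apply: ck_add => //.
  (* The empty list in [slots A [::] bs] is generalised so that the sum can be treated by induction
     on [bs]. *)
  have : allP (@lin_cont Z) [::] by [].
  move: [::] => pre cpre; elim: bs pre cpre cbs => [|b bs ihb] pre cpre cbs.
    exact: ck_cst.
  case: cbs => cb cbs; apply: ck_add => //; last first.
    by apply: ihb => //; rewrite -cats1 allP_cat.
  pose cs := [seq (fun z : Z * Z => b' z.1) | b' <- pre] ++
    (fun z => b z.2) :: [seq (fun z : Z * Z => b' z.1) | b' <- bs].
  have ccs : allP (@lin_cont (Z * Z)%type) cs.
    rewrite /cs allP_cat /= !allP_map; split; first exact: allP_imp cpre.
    by split; [exact: lc2|exact: allP_imp cbs].
  have h := ih _ (fun z => A z.1) cs lZZ (lc1 _ cA) ccs.
  have HE : (fun z => Df [seq b z | b <- cs] (A z.1)) =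
    (fun z => Df ([seq b z.1 | b <- pre] ++ b z.2 :: [seq b z.1 | b <- bs])
      (A z.1)).
    by apply/funext => z; rewrite /cs map_cat /= -!map_comp.
  by rewrite HE in h; apply: ck_sub h => z [].
pose cs := rcons [seq (fun z : Z * Z => b z.1) | b <- bs] (fun z => A z.2).
have ccs : allP (@lin_cont (Z * Z)%type) cs.
  rewrite /cs -cats1 allP_cat /= !allP_map; split; first exact: allP_imp cbs.
  by split=> //; exact: lc2.
have h := ih _ (fun z => A z.1) cs lZZ (lc1 _ cA) ccs.
by apply: ck_sub h => z [].
Qed.

Theorem smooth_on_ck k : ck k U f.
Proof.
have idc : lin_cont (@id X) by split=> // x; exact: cvg_id.
exact: (@ck_term k X id [::] lX idc I).
Qed.

End SmoothCk.

(** * Maps into the Lie group *)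

Section LieMaps.
Context {R : realType} {E : tvsType R} {G : lieGroupType E}.
Hypothesis sE : separated E.
Implicit Types Z : preTopologicalLmodType R.

Let lE : lcs E := @lcs_tvs R E.
Let lEE : lcs (E * E)%type := lcs_prod lE lE.

(** Continuity is a clause of its own because it makes the domains in the second clause open
    ([group_ck_open]). *)
Definition group_ck k Z (W : set Z) (f : Z -> G) :=
  (forall z, W z -> {for z, continuous f}) /\
  forall psi, lie_atlas G psi ->
    ck k (W `&` f @^-1` dom psi) (fun z => to_model psi (f z)).

Lemma open_preimage_on (Z T : topologicalType) (W : set Z) (f : Z -> T)
  (A : set T) :
  open W -> open A -> (forall z, W z -> {for z, continuous f}) ->
  open (W `&` f @^-1` A).
Proof.
move=> oW oA cf; rewrite openE => z [Wz Az].
have h : \forall y \near z, A (f y).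
  exact: (cf z Wz A (open_nbhs_nbhs (conj oA Az))).
exact: filterI (open_nbhs_nbhs (conj oW Wz)) h.
Qed.

Lemma group_ck_open k Z (W : set Z) (f : Z -> G) (psi : chart G E) :
  open W -> group_ck k W f ->
  open (W `&` f @^-1` dom psi).
Proof. by move=> oW [cf _]; apply: open_preimage_on => //; exact: open_dom. Qed.

Lemma group_ck_of_model k psi :
  lie_atlas G psi -> group_ck k (cod psi) (of_model psi).
Proof.
move=> Apsi; split=> [z|psi' Apsi']; first exact: of_continuous.
have [_ /(_ psi psi' Apsi Apsi') tr] := lie_atlasP G.
apply: smooth_on_ck => //.
apply: open_preimage_on; [exact: open_cod|exact: open_dom|].
by move=> z; exact: of_continuous.
Qed.

Lemma group_ck_cst k Z (W : set Z) (g : G) : group_ck k W (fun _ => g).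
Proof.
split=> [z _|psi _]; first exact: const_continuous.
exact: ck_cst.
Qed.

Lemma group_ck_comp k Z Z' (W : set Z) (W' : set Z') (h : Z' -> Z) (f : Z -> G)
  :
  lcs Z -> lcs Z' -> open W -> open W' ->
  ck k W' h -> group_ck k W f -> (forall z, W' z -> W (h z)) ->
  group_ck k W' (fun z => f (h z)).
Proof.
move=> lZ lZ' oW oW' ch cf WW; split=> [z W'z|psi Apsi].
  apply: (@continuous_comp _ _ _ h f); first exact: ck_cont ch W'z.
  by apply: cf.1; exact: WW.
apply: (ck_comp (V := W `&` f @^-1` dom psi) (f := h) (g := fun z =>
  to_model psi (f z))) => //.
- apply: (@open_preimage_on _ _ _ (f \o h)) => //; first exact: open_dom.
  move=> z W'z; apply: continuous_comp; first exact: ck_cont ch W'z.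
  by apply: cf.1; exact: WW.
- exact: group_ck_open cf.
- by apply: ck_sub ch => z [].
- exact: cf.2.
- by move=> z [/WW].
Qed.

(** A chart [phi] around [f z] is inserted locally, which leaves the local representative of [m]
    composed with that of [f]. *)
Lemma group_ck_smooth_map k Z (W : set Z) (F : preTopologicalLmodType R)
  (T : topologicalType)
    (f : Z -> G) (m : G -> T) (psi : chart T F) :
  lcs Z -> lcs F -> separated F -> open W -> continuous m -> group_ck k W f ->
  (forall phi, lie_atlas G phi ->
     smooth_on [set u | cod phi u /\ dom psi (m (of_model phi u))]
       (to_model psi \o m \o of_model phi)) ->
  ck k (W `&` (fun z => m (f z)) @^-1` dom psi)
    (fun z => to_model psi (m (f z))).
Proof.
move=> lZ lF sF oW cm cf sm; apply: ck_local => // z [Wz mz].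
have [phi Aphi fz] := (lie_atlasP G).1 (f z).
have oD : open [set u | cod phi u /\ dom psi (m (of_model phi u))].
  apply: (@open_preimage_on _ _ _ (m \o of_model phi)).
  - exact: open_cod.
  - exact: open_dom.
  - by move=> u cu; apply: continuous_comp; [exact: of_continuous|exact: cm].
pose W1 := (W `&` f @^-1` dom phi) `&` (fun z => m (f z)) @^-1` dom psi.
have oW1 : open W1.
  apply: open_preimage_on; [exact: group_ck_open cf|exact: open_dom|].
  by move=> y [Wy _]; apply: continuous_comp; [exact: cf.1|exact: cm].
exists W1; split=> //.
apply: (ck_ext (f := fun y => (to_model psi \o m \o of_model phi)
  (to_model phi (f y)))) => //.
  by move=> y [[Wy fy] _] /=; rewrite to_modelK.
apply: (ck_comp (V := [set u | cod phi u /\ dom psi (m (of_model phi u))])) =>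
  //.
- by apply: ck_sub (cf.2 _ Aphi) => y [].
- exact: smooth_on_ck lE lF sF oD (sm phi Aphi) k.
- by move=> y [[Wy fy] my]; split; [exact: to_cod|rewrite /= to_modelK].
Qed.

Lemma group_ck_inv k Z (W : set Z) (f : Z -> G) : lcs Z -> open W ->
  group_ck k W f -> group_ck k W (fun z => (f z)^-1%g).
Proof.
move=> lZ oW cf; have [ci si] := lie_inv_smooth G; split.
  by move=> z Wz; apply: (@continuous_comp _ _ _ f (fun x : G => x^-1%g));
    [exact: cf.1|exact: ci].
move=> psi Apsi; apply: (group_ck_smooth_map (m := fun x : G => x^-1%g)) =>
  // phi Aphi.
exact: si.
Qed.

Lemma group_ck_mul k Z (W : set Z) (f g : Z -> G) : lcs Z -> open W ->
  group_ck k W f -> group_ck k W g -> group_ck k W (fun z => (f z * g z)%g).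
Proof.
move=> lZ oW cf cg; have [cm sm] := lie_mul_smooth G.
have cfg z : W z -> {for z, continuous (fun z => (f z * g z)%g)}.
  move=> Wz; apply: (@continuous_comp _ _ _ (fun z => (f z, g z))
    (fun p : G * G => (p.1 * p.2)%g)); last exact: cm.
  by apply: continuous_pair; [exact: cf.1|exact: cg.1].
split=> // psi Apsi; apply: ck_local => // z [Wz mz].
have [phi Aphi fz] := (lie_atlasP G).1 (f z).
have [phi' Aphi' gz] := (lie_atlasP G).1 (g z).
pose Phi := prod_chart phi phi'; pose m (p : G * G) := (p.1 * p.2)%g.
have sPhi := sm Phi psi (ex_intro2 _ _ phi Aphi
  (ex_intro2 _ _ phi' Aphi' erefl)) Apsi.
have oD : open [set u | cod Phi u /\ dom psi (m (of_model Phi u))].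
  apply: (@open_preimage_on _ _ _ (m \o of_model Phi)).
  - exact: open_cod.
  - exact: open_dom.
  - by move=> u cu; apply: continuous_comp; [exact: of_continuous|exact: cm].
pose W1 := ((W `&` f @^-1` dom phi) `&` (W `&` g @^-1` dom phi')) `&`
  (W `&` (fun z => (f z * g z)%g) @^-1` dom psi).
have oW1 : open W1.
  apply: openI; first by apply: openI;
    [exact: group_ck_open cf|exact: group_ck_open cg].
  by apply: open_preimage_on => //; exact: open_dom.
exists W1; split=> //.
apply: (ck_ext (f := fun y => (to_model psi \o m \o of_model Phi)
  (to_model phi (f y), to_model phi' (g y)))) => //.
  by move=> y [[[Wy fy] [_ gy]] _]; rewrite /= /m /= !to_modelK.
apply: (ck_comp (V := [set u | cod Phi u /\ dom psi (m (of_model Phi u))])) =>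
  //.
- apply: ck_pair.
    by apply: ck_sub (cf.2 _ Aphi) => y [[]].
  by apply: ck_sub (cg.2 _ Aphi') => y [[]].
- exact: smooth_on_ck lEE lE sE oD sPhi k.
- move=> y [[[Wy fy] [_ gy]] [_ my]]; split=> /=.
    by split; exact: to_cod.
  by rewrite /m /= !to_modelK.
Qed.

End LieMaps.

(** By homogeneity; scaling by [e + q x] rather than [q x] covers the case [q x = 0]. *)
Lemma seminorm_le (R : realType) (X : lmodType R) (p q : X -> R) :
  seminorm p -> seminorm q -> (forall x, q x < 1 -> p x <= 1) ->
  forall x, p x <= q x.
Proof.
move=> sp sq pq x; apply/ler_addgt0Pl => e e0.
have r0 : 0 < e + q x by rewrite ltr_pwDl// seminorm_ge0.
have : q ((e + q x)^-1 *: x) < 1.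
  rewrite (seminormZ sq) gtr0_norm ?invr_gt0// ltr_pdivrMl// mulr1.
  by rewrite ltrDr.
by move=> /pq; rewrite (seminormZ sp) gtr0_norm ?invr_gt0// ler_pdivrMl// mulr1.
Qed.

(** * The derived representation *)

Section Rep.
Context {R : realType} {E : tvsType R} {G : lieGroupType E}
  {V : hausdorffTvsType R}.
Context (pi : G -> {linear V -> V}).
Hypothesis pi_rep : is_representation pi.
Hypothesis pi_continuous : continuous (fun p : G * V => pi p.1 p.2).
Context (phi : chart G E) (phi_atlas : lie_atlas G phi) (phi1 : dom phi 1%g).
Context (N : E -> R) (N_norm : lie_algebra_norm phi N).
Context (expG : E -> G) (expG_exp : is_exponential phi expG).
Implicit Types Z : preTopologicalLmodType R.

Local Notation e0 := (to_model phi 1%g).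
Local Notation dpi := (derived_rep pi expG).

Lemma csn_N : csn N.
Proof.
have [sN _ nN _] := N_norm; split=> // x e e0.
have h : nbhs (0 : E) [set y | N y < e] by apply/nN; exists e.
have := @sub_continuous E (x, x); rewrite /continuous_at /= subrr => /(_ _ h).
move=> [[A B] [/= Ax Bx]] AB; apply: filterS Ax => y Ay.
by apply: (AB (y, x)); split=> //=; exact: nbhs_singleton Bx.
Qed.

Lemma separated_E : separated E.
Proof. by move=> x H; have [_ N0 _ _] := N_norm; apply: N0; apply: H csn_N. Qed.

Lemma N_dominates p : csn p -> exists2 C, 0 <= C & forall x, p x <= C * N x.
Proof.
move=> [sp cp]; have [sN _ nN _] := N_norm.
have /nN[e e0 eN] : nbhs (0 : E) [set y | p (y - 0) < 1] by exact: cp.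
exists e^-1; first by rewrite invr_ge0 ltW.
apply: seminorm_le => // [|x].
  by apply: csnS; apply: csnZ; [rewrite invr_ge0 ltW|exact: csn_N].
by rewrite ltr_pdivrMl// mulr1 => /eN /=; rewrite subr0 => /ltW.
Qed.

Let lE : lcs E := @lcs_tvs R E.
Let lV : lcs V := @lcs_tvs R V.
Let sE : separated E := separated_E.
Let sV : separated V := hausdorff_separated (@tvs_hausdorff R V).

Lemma pi1 v : pi 1%g v = v. Proof. by case: pi_rep. Qed.
Lemma piM g h v : pi (g * h)%g v = pi g (pi h v). Proof. by case: pi_rep. Qed.

Lemma pi_continuousr g : continuous (pi g).
Proof.
move=> v; apply: (@continuous_comp _ _ _ (fun v => (g, v)) (fun p : G * V =>
  pi p.1 p.2)).
  by apply: continuous_pair; [exact: const_continuous|exact: cvg_id].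
exact: pi_continuous.
Qed.

Lemma pi_continuousl v : continuous (fun g => pi g v).
Proof.
move=> g; apply: (@continuous_comp _ _ _ (fun g => (g, v)) (fun p : G * V =>
  pi p.1 p.2)).
  by apply: continuous_pair; [exact: cvg_id|exact: const_continuous].
exact: pi_continuous.
Qed.

(** Joint continuity at [(g0, 0)] gives one seminorm ball that all [pi g] with [g] near [g0] map
    into the unit ball of [p]; homogeneity does the rest. *)
Lemma pi_equicontinuous (g0 : G) (p : V -> R) : csn p ->
  exists2 q, csn q & \forall g \near g0, forall v, p (pi g v) <= q v.
Proof.
move=> cp; have := @pi_continuous (g0, 0) _ (csn_ball cp (pi g0 0) ltr01).
move=> [[A B] [/= Ag /lV[q cq qB]] AB]; exists q => //.
apply: filterS Ag => g Ag; apply: seminorm_le; last 1 first.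
- move=> v qv; have := AB (g, v); rewrite /= linear0 subr0 => h; apply/ltW/h.
  by split=> //=; apply: qB; rewrite subr0.
- case: (csnS cp) => pD pZ.
  by split=> [x y|a x]; rewrite ?linearD ?linearZ_LR.
- exact: csnS.
Qed.

Lemma expG0 : expG 0 = 1%g.
Proof.
have [_ eD _] := expG_exp 0; have := eD 0 0; rewrite addr0 scale0r => h.
by have := mulg1 (expG 0); rewrite [in RHS]h => /mulgI.
Qed.

Lemma expGD x (s t : R) : expG ((s + t) *: x) =
  (expG (s *: x) * expG (t *: x))%g.
Proof. by have [_ eD _] := expG_exp x. Qed.

Lemma expG_continuous x : continuous (fun t : R => expG (t *: x)).
Proof. by have [[c _] _ _] := expG_exp x. Qed.

Lemma expG_dom x : \forall t \near (0 : R), dom phi (expG (t *: x)).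
Proof.
have h : nbhs (expG ((0 : R) *: x)) (dom phi).
  by rewrite scale0r expG0; apply: open_nbhs_nbhs; split=> //; exact: open_dom.
exact: (@expG_continuous x 0 _ h).
Qed.

Lemma expG_cvg x :
  (fun t : R => t^-1 *: (to_model phi (expG (t *: x)) - e0)) @ 0^' --> x.
Proof.
have [[_ /(_ _ phi erefl phi_atlas) [sm _]] _ d] := expG_exp x.
have [|l dl] := sm [::] (1 : R^o) (0 : R^o).
  by split=> //=; rewrite scale0r expG0.
have := diffquot_dir_derive sE dl; rewrite {1}/iter_dir_derive /= d => E'.
move: dl; rewrite -E'; apply: cvg_trans; apply: near_eq_cvg; apply: nearW => t.
rewrite /diffquot /= add0r scale0r expG0;
  congr (_ *: (to_model phi (expG (_ *: x)) - _)).
exact: mulr1.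
Qed.

Lemma smooth_vector_ck v : smooth_vector pi v -> forall psi k,
  lie_atlas G psi ->
  ck k (cod psi) (fun u => pi (of_model psi u) v).
Proof.
move=> [_ sm] psi k Apsi; have := sm psi (id_chart V) Apsi erefl.
have -> : [set u | cod psi u /\ dom (id_chart V) (pi (of_model psi u) v)] =
  cod psi.
  by apply/seteqP; split=> u //= [].
by move=> h; exact: (smooth_on_ck lE lV sV (@open_cod _ _ psi) h k).
Qed.

Lemma ck_smooth_vector v : (forall psi, lie_atlas G psi ->
  forall k, ck k (cod psi) (fun u => pi (of_model psi u) v)) ->
    smooth_vector pi v.
Proof.
move=> cv; split; first exact: pi_continuousl.
move=> psi psi' Apsi ->.
have -> : [set u | cod psi u /\ dom (id_chart V) (pi (of_model psi u) v)] =
  cod psi.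
  by apply/seteqP; split=> u //= [].
by apply: ck_smooth_on => //; [exact: open_cod|exact: cv].
Qed.

Let f0 v y := pi (of_model phi y) v.

Lemma cod_e0 : cod phi e0. Proof. exact: to_cod. Qed.

(** Every curve with velocity [x] at [e0] gives the same derivative, because it is a line in the
    varying direction [t^-1 *: (c t - e0)]. *)
Lemma orbit_curve v (c : R -> E) x : smooth_vector pi v ->
  (fun t => t^-1 *: (c t - e0)) @ 0^' --> x ->
  (fun t => t^-1 *: (pi (of_model phi (c t)) v - v)) @ 0^' -->
    dir_derive x (f0 v) e0.
Proof.
move=> sv cx; have [_ [df [ddf cdf]]] := smooth_vector_ck sv 1 phi_atlas.
rewrite (diffquot_dir_derive sV (ddf _ x cod_e0)).
have : (fun t => t^-1 *: (f0 v (e0 + t *: (t^-1 *: (c t - e0))) - f0 v e0))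
  @ 0^' -->
    df (e0, x).
  apply: (@diff_curve0 _ _ _ (cod phi)) => //; first exact: open_cod.
    by move=> y h cy; apply: cdf.
  exact: cod_e0.
apply: cvg_trans; apply: near_eq_cvg.
apply: filterS (nbhs_dnbhs_neq (0 : R)) => t t0 /=.
by rewrite scalerA divff// scale1r subrKC /f0 to_modelK// pi1.
Qed.

(** This trades the exponential curve for a line in the chart, whence linearity in [x] and the
    freedom to compute [dpi x v] along any curve of velocity [x]. *)
Lemma derived_rep_chart v x : smooth_vector pi v ->
  dpi x v = dir_derive x (f0 v) e0.
Proof.
move=> sv; apply: (diffquot_dir_derive sV).
have := orbit_curve sv (@expG_cvg x); apply: cvg_trans; apply: near_eq_cvg.
apply: nbhs_dnbhs; apply: filterS (expG_dom x) => t dt.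
rewrite /diffquot /= to_modelK// add0r scale0r expG0 pi1;
  congr (_ *: (pi (expG (_ *: x)) v - _)).
exact/esym/mulr1.
Qed.

Lemma derived_rep_cvg v (c : R -> E) x : smooth_vector pi v ->
  (fun t => t^-1 *: (c t - e0)) @ 0^' --> x ->
  (fun t => t^-1 *: (pi (of_model phi (c t)) v - v)) @ 0^' --> dpi x v.
Proof. by move=> sv cx; rewrite derived_rep_chart//; exact: orbit_curve. Qed.

Lemma derived_rep_exp v x : smooth_vector pi v ->
  (fun t : R => t^-1 *: (pi (expG (t *: x)) v - v)) @ 0^' --> dpi x v.
Proof.
move=> sv; have := derived_rep_cvg sv (@expG_cvg x); apply: cvg_trans.
apply: near_eq_cvg; apply: nbhs_dnbhs.
by apply: filterS (expG_dom x) => t dt; rewrite to_modelK.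
Qed.

Lemma derived_rep_line v x : smooth_vector pi v ->
  (fun t : R => t^-1 *: (pi (of_model phi (e0 + t *: x)) v - v)) @ 0^' -->
    dpi x v.
Proof.
move=> sv; apply: derived_rep_cvg => //.
have : (fun _ : R => x) @ 0^' --> x by exact: cvg_cst.
apply: cvg_trans; apply: near_eq_cvg.
apply: filterS (nbhs_dnbhs_neq (0 : R)) => t t0 /=.
by rewrite addrAC subrr add0r scalerA mulVf// scale1r.
Qed.

Lemma derived_rep_linearl v : smooth_vector pi v -> linear (fun x => dpi x v).
Proof.
move=> sv a x y; rewrite !derived_rep_chart//.
have [_ [df [ddf cdf]]] := smooth_vector_ck sv 1 phi_atlas.
rewrite !(diffquot_dir_derive sV (ddf _ _ cod_e0)).
apply: (diff_linear (U := cod phi) (f := f0 v)) => //; first exact: open_cod.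
  by move=> z h cz; apply: cdf.
exact: cod_e0.
Qed.

Lemma smooth_vectorP a v w : smooth_vector pi v -> smooth_vector pi w ->
  smooth_vector pi (a *: v + w).
Proof.
move=> sv sw; have [_ H] := smooth_vectors_submod_closed pi.
exact: asboolW (H a v w (asboolT sv) (asboolT sw)).
Qed.

Lemma derived_rep_linearr x a v w : smooth_vector pi v -> smooth_vector pi w ->
  dpi x (a *: v + w) = a *: dpi x v + dpi x w.
Proof.
move=> sv sw.
apply: (lcs_cvg_unique sV (@derived_rep_line _ x (smooth_vectorP a sv sw))).
have h1 := @derived_rep_line _ x sv; have h2 := @derived_rep_line _ x sw.
have := @lcs_cvgD R V R (0 : R)^' (dnbhs_filter _) _ _ _ _ lV
  (@lcs_cvgZr R V R (0 : R)^' (dnbhs_filter _) a _ _ lV h1) h2.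
apply: cvg_trans; apply: near_eq_cvg; apply: nearW => t /=.
rewrite linearP scalerA mulrC -scalerA -scalerDr scalerBr opprD.
by rewrite addrACA.
Qed.

(** Joint smoothness in the group element and the parameter. It forces each [v z] to be a smooth
    vector, and it is stable under translation and under [dpi x], even jointly in [x]. *)
Definition smooth_family Z (W : set Z) (v : Z -> V) := forall psi,
  lie_atlas G psi ->
  forall k, ck k (cod psi `*` W) (fun z : E * Z =>
    pi (of_model psi z.1) (v z.2)).

Lemma smooth_family_ck k Z Z' (W : set Z) (W' : set Z') v (f : Z' -> G)
  (h : Z' -> Z) :
  lcs Z -> lcs Z' -> open W -> open W' -> smooth_family W v ->
    group_ck k W' f -> ck k W' h ->
  (forall z, W' z -> W (h z)) -> ck k W' (fun z => pi (f z) (v (h z))).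
Proof.
move=> lZ lZ' oW oW' jv cf ch WW; apply: ck_local => // z W'z.
have [psi Apsi fz] := (lie_atlasP G).1 (f z).
have oW1 := group_ck_open psi oW' cf.
exists (W' `&` f @^-1` dom psi); split=> //.
apply: (ck_ext (f := fun y => pi (of_model psi (to_model psi (f y)))
  (v (h y)))) => //.
  by move=> y [_ fy]; rewrite to_modelK.
apply: (ck_comp (V := cod psi `*` W) (f := fun y => (to_model psi (f y), h y))
  (g := fun z : E * Z => pi (of_model psi z.1) (v z.2))) => //.
- exact: lcs_prod.
- by apply: open_setX => //; exact: open_cod.
- by apply: ck_pair; [exact: cf.2|apply: ck_sub ch => y []].
- exact: jv.
- by move=> y [/WW Wy fy]; split=> //; exact: to_cod.
Qed.

Lemma ck_proj1 k Z Z' (W : set (Z * Z')) : lcs Z -> lcs Z' -> ck k W fst.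
Proof. by move=> lZ lZ'; apply: ck_fst; apply: ck_id; exact: lcs_prod. Qed.

Lemma ck_proj2 k Z Z' (W : set (Z * Z')) : lcs Z -> lcs Z' -> ck k W snd.
Proof. by move=> lZ lZ'; apply: ck_snd; apply: ck_id; exact: lcs_prod. Qed.

Lemma group_ck_of_model_fst k Z (W : set Z) (psi : chart G E) :
  lcs Z -> open W ->
  lie_atlas G psi -> group_ck k (cod psi `*` W) (fun z : E * Z =>
    of_model psi z.1).
Proof.
move=> lZ oW Apsi.
apply: (group_ck_comp (W := cod psi) (h := fst) (f := of_model psi)) => //.
- exact: lcs_prod.
- exact: open_cod.
- by apply: open_setX => //; exact: open_cod.
- exact: ck_proj1.
- exact: group_ck_of_model.
- by move=> z [].
Qed.

Lemma const_smooth_family Z (W : set Z) v :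
  lcs Z -> open W -> smooth_vector pi v ->
  smooth_family W (fun _ => v).
Proof.
move=> lZ oW sv psi Apsi k; have cv := smooth_vector_ck sv k Apsi.
apply: (ck_comp (V := cod psi) (f := fst) (g := fun u =>
  pi (of_model psi u) v)) => //.
- exact: lcs_prod.
- by apply: open_setX => //; exact: open_cod.
- exact: open_cod.
- exact: ck_proj1.
- by move=> z [].
Qed.

Lemma smooth_family_smooth Z (W : set Z) v z :
  lcs Z -> open W -> smooth_family W v -> W z ->
  smooth_vector pi (v z).
Proof.
move=> lZ oW jv Wz; apply: ck_smooth_vector => psi Apsi k.
apply: (smooth_family_ck (Z' := E) (h := fun _ => z) lZ _ oW _ jv) => //.
- exact: open_cod.
- exact: group_ck_of_model.
- exact: ck_cst.
Qed.

Lemma smooth_family_comp Z Z' (W : set Z) (W' : set Z') v (h : Z' -> Z) :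
  lcs Z -> lcs Z' -> open W -> open W' -> smooth_family W v ->
    (forall k, ck k W' h) ->
  (forall z, W' z -> W (h z)) -> smooth_family W' (fun z => v (h z)).
Proof.
move=> lZ lZ' oW oW' jv ch WW psi Apsi k.
apply: (smooth_family_ck (Z' := (E * Z')%type) (h := fun z => h z.2) lZ _ oW _
  jv) => //.
- exact: lcs_prod.
- by apply: open_setX => //; exact: open_cod.
- exact: group_ck_of_model_fst.
- apply: (ck_comp (V := W') (f := snd) (g := h)) => //.
  + exact: lcs_prod.
  + by apply: open_setX => //; exact: open_cod.
  + exact: ck_proj2.
  + by move=> z [].
- by move=> z [_ /WW].
Qed.

Lemma smooth_family_translate Z (W : set Z) v (f : Z -> G) :
  lcs Z -> open W -> smooth_family W v ->
  (forall k, group_ck k W f) -> smooth_family W (fun z => pi (f z) (v z)).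
Proof.
move=> lZ oW jv cf psi Apsi k.
have oD : open (cod psi `*` W) by apply: open_setX => //; exact: open_cod.
have lEZ := lcs_prod lE lZ.
have : ck k (cod psi `*` W) (fun z : E * Z =>
  pi (of_model psi z.1 * f z.2)%g (v z.2)).
  apply: (smooth_family_ck (h := snd) lZ _ oW _ jv) => //.
  - apply: group_ck_mul => //; first exact: group_ck_of_model_fst.
    apply: (group_ck_comp (W := W) (h := snd) (f := f)) => //;
      first exact: ck_proj2.
    by move=> z [].
  - exact: ck_proj2.
  - by move=> z [].
by apply: ck_ext => // z _; rewrite piM.
Qed.

(** With [c] the inverse of the chart [phi], [pi g (dpi x (v z))] is the derivative of
    [pi (g * c y) (v z)] at [y = e0] in direction [x], and a partial derivative of a jointly smooth
    map is jointly smooth, in the direction as well. *)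
Lemma smooth_family_derived Z (W : set Z) v :
  lcs Z -> open W -> smooth_family W v ->
  smooth_family ([set: E] `*` W) (fun z : E * Z => dpi z.1 (v z.2)).
Proof.
move=> lZ oW jv psi Apsi k.
pose Z3 := (E * (E * Z))%type.
have lEZ := lcs_prod lE lZ; have lZ3 : lcs Z3 := lcs_prod lE lEZ.
pose D : set Z3 := cod psi `*` (cod phi `*` W).
have oD : open D.
  apply: open_setX; first exact: open_cod.
  by apply: open_setX => //; exact: open_cod.
have oD' : open (cod psi `*` ([set: E] `*` W)).
  apply: open_setX; first exact: open_cod.
  by apply: open_setX => //; exact: openT.
pose J (z : Z3) := pi (of_model psi z.1 * of_model phi z.2.1)%g (v z.2.2).
have cJ : ck k.+1 D J.
  apply: (smooth_family_ck (h := fun z : Z3 => z.2.2) lZ _ oW _ jv) => //.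
  - apply: group_ck_mul => //.
      by apply: group_ck_of_model_fst => //; apply: open_setX => //;
        exact: open_cod.
    apply: (group_ck_comp (W := cod phi) (h := fun z : Z3 => z.2.1)) => //.
    + exact: open_cod.
    + by apply: ck_fst; exact: ck_proj2.
    + exact: group_ck_of_model.
    + by move=> z [_ []].
  - by apply: ck_snd; exact: ck_proj2.
  - by move=> z [_ []].
have [cDJ dJ] := ck_dir_derive lZ3 oD sV cJ.
have : ck k (cod psi `*` ([set: E] `*` W)) (fun z : Z3 =>
    dir_derive (0, (z.2.1, 0)) J (z.1, (e0, z.2.2))).
  apply: (ck_comp (V := D `*` setT)
    (f := fun z : Z3 => ((z.1, (e0, z.2.2)), (0, (z.2.1, 0))) : Z3 * Z3)
    (g := fun z => dir_derive z.2 J z.1)) => //.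
  - exact: lcs_prod.
  - exact: open_setXT.
  - apply: ck_pair; apply: ck_pair.
    + exact: ck_proj1.
    + by apply: ck_pair; [exact: ck_cst|apply: ck_snd; exact: ck_proj2].
    + exact: ck_cst.
    + by apply: ck_pair; [apply: ck_fst; exact: ck_proj2|exact: ck_cst].
  - by move=> z [cz [_ Wz]]; split=> //; split=> //; split=> //; exact: cod_e0.
apply: ck_ext => // -[u [x z]] [/= cu [_ Wz]].
apply: (diffquot_dir_derive sV).
have sv := smooth_family_smooth lZ oW jv Wz.
have := cvg_comp _ _ (@derived_rep_line _ x sv)
  (@pi_continuousr (of_model psi u) (dpi x (v z))).
apply: cvg_trans; apply: near_eq_cvg; apply: nearW => t /=.
rewrite /diffquot /J /= !scaler0 !addr0 linearZ_LR linearB /=.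
by rewrite !piM to_modelK// pi1.
Qed.

Lemma smooth_translate g v : smooth_vector pi v -> smooth_vector pi (pi g v).
Proof.
move=> sv; have jv := const_smooth_family lE (@openT E) sv.
have jv' := smooth_family_translate lE (@openT E) jv
  (fun k => group_ck_cst k setT g).
exact: (smooth_family_smooth (z := 0) lE (@openT E) jv').
Qed.

Lemma smooth_derived x v : smooth_vector pi v -> smooth_vector pi (dpi x v).
Proof.
move=> sv; have jv := smooth_family_derived lE (@openT E)
  (const_smooth_family lE (@openT E) sv).
have oT : open ([set: E] `*` [set: E]) by apply: open_setX; exact: openT.
exact: (smooth_family_smooth (z := (x, 0)) (lcs_prod lE lE) oT jv).
Qed.

(** * Logarithmic derivative and adjoint action *)

Section PartialDerivative.
Context (O : set E) (W : set (E * E)%type) (f : E * E -> G) (s : E -> E).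
Hypotheses (oO : open O) (oW : open W) (cf : forall k, group_ck k W f)
  (cs : forall k, ck k O s) (sW : forall u, O u -> W (u, s u))
  (fs1 : forall u, O u -> f (u, s u) = 1%g).

Let g z := to_model phi (f z).
Let D := W `&` f @^-1` dom phi.
Let oD : open D. Proof. exact: group_ck_open (cf 0). Qed.
Let lEE : lcs (E * E)%type. Proof. exact: lcs_prod. Qed.
Let cg k : ck k D g. Proof. by apply: (cf k).2. Qed.
Let sD u : O u -> D (u, s u). Proof. by move=> Ou; split;
  [exact: sW|rewrite /= fs1]. Qed.

(* A tangent vector at [1], since [f (u, s u) = 1]. *)
Definition partial_at1 (u h : E) : E := dir_derive (0, h) g (u, s u).

Lemma partial_at1_ck k : ck k (O `*` setT) (fun z : E * E =>
  partial_at1 z.1 z.2).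
Proof.
have [cDg dg] := ck_dir_derive lEE oD sE (cg k.+1).
apply: (ck_comp (V := D `*` setT) (f := fun z : E * E =>
  ((z.1, s z.1), (0, z.2)) : (E * E) * (E * E))
  (g := fun z => dir_derive z.2 g z.1)) => //.
- exact: lcs_prod.
- exact: open_setXT.
- exact: open_setXT.
- apply: ck_pair; apply: ck_pair.
  + exact: ck_proj1.
  + apply: (ck_comp (V := O) (f := fst) (g := s)) => //;
    first exact: open_setXT.
      exact: ck_proj1.
    by move=> z [].
  + exact: ck_cst.
  + exact: ck_proj2.
- by move=> z [Oz _]; split=> //; exact: sD.
Qed.

Lemma partial_at1_linear u : O u -> linear (partial_at1 u).
Proof.
move=> Ou a h h'; have [cDg dg] := ck_dir_derive lEE oD sE (cg 1).
have := diff_linear (df := fun z => dir_derive z.2 g z.1) lEE lE sE oD.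
move=> /(_ g) H; have {}H := H dg (fun x h Dx =>
  ck_cont (x := (x, h)) cDg (conj Dx I)) _ (sD Ou) a (0, h) (0, h').
have E' : (0, a *: h + h') = a *: (0, h) + (0, h') :> E * E.
  by congr pair; rewrite /= scaler0 addr0.
by rewrite /partial_at1 E'; exact: H.
Qed.

Lemma partial_at1_cvg u h v : O u -> smooth_vector pi v ->
  (fun t : R => t^-1 *: (pi (f (u, s u + t *: h)) v - v)) @ 0^' -->
    dpi (partial_at1 u h) v.
Proof.
move=> Ou sv; have [cDg dg] := ck_dir_derive lEE oD sE (cg 1).
have dgu := dg (u, s u) (0, h) (sD Ou).
have E' (t : R) : (u, s u) + t *: (0, h) = (u, s u + t *: h) :> E * E.
  by congr pair; rewrite /= scaler0 addr0.
have gu : g (u, s u) = e0 by rewrite /g fs1.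
have cg' : (fun t : R => t^-1 *: (g (u, s u + t *: h) - e0)) @ 0^' -->
  partial_at1 u h.
  apply: cvg_trans dgu; apply: near_eq_cvg; apply: nearW => t.
  by rewrite /diffquot E' gu.
have := derived_rep_cvg sv cg'; apply: cvg_trans; apply: near_eq_cvg;
  apply: nbhs_dnbhs.
have := near_line (0, h) lEE (open_nbhs_nbhs (conj oD (sD Ou))).
by apply: filterS => t; rewrite E' => -[_ dt]; rewrite /g to_modelK.
Qed.

(** A locally uniform operator norm bound: continuity at [(u0, 0)] controls all small [h] for all
    [u] near [u0] at once, and linearity in [h] extends this to every [h]. *)
Lemma partial_at1_bound u0 : O u0 -> exists2 C, 0 <= C &
  \forall u \near u0, forall h, N (partial_at1 u h) <= C * N h.
Proof.
move=> Ou0; have sN := csnS csn_N.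
have l0 u : O u -> partial_at1 u 0 = 0.
  by move=> Ou; exact: linear0_of (partial_at1_linear Ou).
have := @ck_cont R E _ 0 _ _ (u0, 0) (partial_at1_ck 0) (conj Ou0 I).
move=> /(_ _ (csn_ball csn_N (partial_at1 u0 0) ltr01)).
move=> [[A B] [/= Au Bz] AB]; have [q cq qB] := lE Bz.
have [C C0 qC] := N_dominates cq; exists C => //.
apply: filterS2 Au (open_nbhs_nbhs (conj oO Ou0)) => u Au Ou.
apply: seminorm_le => [||h qh].
- split=> [x y|a x].
    have := partial_at1_linear Ou 1 x y; rewrite !scale1r => ->.
    exact: seminormD.
  by rewrite (linearZ_of (partial_at1_linear Ou)); exact: seminormZ.
- by apply: csnS; apply: csnZ => //; exact: csn_N.
- have := AB (u, h); rewrite /= l0// subr0 => H; apply/ltW/H; split=> //=.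
  by apply: qB; rewrite subr0; apply: le_lt_trans qh.
Qed.

End PartialDerivative.

Section Chart.
Context (psi : chart G E) (psi_atlas : lie_atlas G psi).

Let ocod : open (cod psi). Proof. exact: open_cod. Qed.
Let lEE : lcs (E * E)%type. Proof. exact: lcs_prod. Qed.

(* With [c = of_model psi], the logarithmic derivative [k] is determined by
   [d/dt c(u + t h) = c(u).k(u, h)] at [t = 0]. *)
Definition log_map (z : E * E) :
  G := ((of_model psi z.1)^-1 * of_model psi z.2)%g.

Definition log_derivative := partial_at1 log_map id.

Let log_open : open (cod psi `*` cod psi). Proof. exact: open_setX. Qed.

Let log_gck k : group_ck k (cod psi `*` cod psi) log_map.
Proof.
apply: group_ck_mul => //.
  by apply: group_ck_inv => //; exact: group_ck_of_model_fst.
apply: (group_ck_comp (W := cod psi) (h := snd) (f := of_model psi)) => //.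
- exact: ck_proj2.
- exact: group_ck_of_model.
- by move=> z [].
Qed.

Let log_id k : ck k (cod psi) (@id E). Proof. exact: ck_id. Qed.
Let log_in u : cod psi u -> (cod psi `*` cod psi) (u, u). Proof. by []. Qed.
Let log1 u : cod psi u -> log_map (u, u) = 1%g.
Proof. by move=> _; rewrite /log_map mulVg. Qed.

Lemma log_derivative_ck k : ck k (cod psi `*` setT) (fun z : E * E =>
  log_derivative z.1 z.2).
Proof. exact: partial_at1_ck ocod log_open log_gck log_id log_in log1 k. Qed.

Lemma log_derivative_linear u : cod psi u -> linear (log_derivative u).
Proof. exact: partial_at1_linear log_open log_gck log_in log1 u. Qed.

Lemma log_derivative_bound u0 : cod psi u0 -> exists2 C, 0 <= C &
  \forall u \near u0, forall h, N (log_derivative u h) <= C * N h.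
Proof. exact: partial_at1_bound ocod log_open log_gck log_id log_in log1 u0.
  Qed.

(** With [c = of_model psi], factoring [c(u + th) = c(u) log_map(u, u + th)] moves the derivative to
    1, behind the continuous operator [pi (c u)]. *)
Lemma orbit_derivative u h v : cod psi u -> smooth_vector pi v ->
  (fun t : R => t^-1 *: (pi (of_model psi (u + t *: h)) v - pi (of_model psi u)
    v)) @ 0^' -->
  pi (of_model psi u) (dpi (log_derivative u h) v).
Proof.
move=> cu sv.
have d := @partial_at1_cvg _ _ _ _ log_open log_gck log_in log1 u h v cu sv.
have := cvg_comp _ _ d (@pi_continuousr (of_model psi u)
  (dpi (log_derivative u h) v)).
apply: cvg_trans; apply: near_eq_cvg; apply: nearW => t /=.
by rewrite linearZ_LR linearB /= -piM /log_map /= mulgA mulgV mul1g.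
Qed.

Definition conj_map (z : E * E) : G :=
  ((of_model psi z.1)^-1 * (of_model phi z.2 * of_model psi z.1))%g.

(** The operator [Ad(c(u))^-1] for [c = of_model psi], read in the chart [phi]. *)
Definition Ad_inv := partial_at1 conj_map (fun=> e0).

Let conj_open : open (cod psi `*` cod phi).
Proof. by apply: open_setX => //; exact: open_cod. Qed.

Let conj_gck k : group_ck k (cod psi `*` cod phi) conj_map.
Proof.
apply: group_ck_mul => //.
  by apply: group_ck_inv => //; apply: group_ck_of_model_fst => //;
    exact: open_cod.
apply: group_ck_mul => //; last by apply: group_ck_of_model_fst => //;
  exact: open_cod.
apply: (group_ck_comp (W := cod phi) (h := snd) (f := of_model phi)) => //.
- exact: open_cod.
- exact: ck_proj2.
- exact: group_ck_of_model.
- by move=> z [].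
Qed.

Let conj_cst k : ck k (cod psi) (fun _ : E => e0). Proof. exact: ck_cst. Qed.
Let conj_in u : cod psi u -> (cod psi `*` cod phi) (u, e0).
Proof. by move=> cu; split=> //; exact: cod_e0. Qed.
Let conj1 u : cod psi u -> conj_map (u, e0) = 1%g.
Proof. by move=> _; rewrite /conj_map /= to_modelK// mul1g mulVg. Qed.

Lemma Ad_inv_bound u0 : cod psi u0 -> exists2 C, 0 <= C &
  \forall u \near u0, forall h, N (Ad_inv u h) <= C * N h.
Proof. exact: partial_at1_bound ocod conj_open conj_gck conj_cst conj_in conj1
  u0. Qed.

(** This is [pi h \o pi g = pi g \o pi (g^-1 h g)], differentiated as [h] runs through 1 with
    velocity [x]. *)
Lemma derived_rep_translate x u v : cod psi u -> smooth_vector pi v ->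
  dpi x (pi (of_model psi u) v) = pi (of_model psi u) (dpi (Ad_inv u x) v).
Proof.
move=> cu sv; apply: (lcs_cvg_unique sV
  (@derived_rep_line _ x (smooth_translate _ sv))).
have d := @partial_at1_cvg _ _ _ _ conj_open conj_gck conj_in conj1 u x v cu sv.
have := cvg_comp _ _ d (@pi_continuousr (of_model psi u) (dpi (Ad_inv u x) v)).
apply: cvg_trans; apply: near_eq_cvg; apply: nearW => t /=.
by rewrite linearZ_LR linearB /= -!piM /conj_map /= mulgA mulgV mul1g.
Qed.

End Chart.

(** * The seminorms on smooth vectors *)

Lemma smooth_foldr xs v : smooth_vector pi v ->
  smooth_vector pi (foldr dpi v xs).
Proof. by move=> sv; elim: xs => [//|x xs ih]; exact: smooth_derived. Qed.

Lemma foldr_derived_linear xs a v w :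
  smooth_vector pi v -> smooth_vector pi w ->
  foldr dpi (a *: v + w) xs = a *: foldr dpi v xs + foldr dpi w xs.
Proof.
move=> sv sw; elim: xs => [//|x xs ih] /=.
by rewrite ih derived_rep_linearr//; exact: smooth_foldr.
Qed.

Lemma smooth_vector0 : smooth_vector pi 0.
Proof.
have [H _] := smooth_vectors_submod_closed pi; exact: asboolW H.
Qed.

Lemma smooth_vectorZ a v : smooth_vector pi v -> smooth_vector pi (a *: v).
Proof.
by move=> sv; rewrite -[_ *: _]addr0; apply: smooth_vectorP => //;
  exact: smooth_vector0.
Qed.

Lemma smooth_vectorD v w : smooth_vector pi v -> smooth_vector pi w ->
  smooth_vector pi (v + w).
Proof. by move=> sv sw; rewrite -[v]scale1r; exact: smooth_vectorP. Qed.

Lemma smooth_vectorB v w : smooth_vector pi v -> smooth_vector pi w ->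
  smooth_vector pi (v - w).
Proof. by move=> sv sw; rewrite addrC -scaleN1r; exact: smooth_vectorP. Qed.

Lemma foldr_derived0 xs : foldr dpi 0 xs = 0.
Proof.
have := foldr_derived_linear xs 1 smooth_vector0 smooth_vector0.
by rewrite scale1r addr0 scale1r => /esym/eqP; rewrite -subr_eq0 addrK => /eqP.
Qed.

Lemma foldr_derivedZ xs a v : smooth_vector pi v ->
  foldr dpi (a *: v) xs = a *: foldr dpi v xs.
Proof.
move=> sv; have := foldr_derived_linear xs a sv smooth_vector0.
by rewrite foldr_derived0 !addr0.
Qed.

Lemma foldr_derivedB xs v w : smooth_vector pi v -> smooth_vector pi w ->
  foldr dpi (v - w) xs = foldr dpi v xs - foldr dpi w xs.
Proof.
move=> sv sw; rewrite addrC -scaleN1r foldr_derived_linear//.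
by rewrite scaleN1r addrC.
Qed.

Lemma derived_rep0l v : smooth_vector pi v -> dpi 0 v = 0.
Proof.
by move=> sv; exact: (linear0_of (derived_rep_linearl sv)).
Qed.

Lemma derived_repZl a x v : smooth_vector pi v -> dpi (a *: x) v = a *: dpi x v.
Proof.
by move=> sv; exact: (linearZ_of (derived_rep_linearl sv) a x).
Qed.

Lemma smooth_family_foldr Z (W : set Z) v xs :
  lcs Z -> open W -> smooth_family W v ->
  smooth_family W (fun z => foldr dpi (v z) xs).
Proof.
move=> lZ oW jv; elim: xs => [//|x xs ih].
have oTW : open ([set: E] `*` W) by apply: open_setX => //; exact: openT.
apply: (smooth_family_comp (W := [set: E] `*` W) (h := fun z => (x, z)) _ lZ
  oTW oW
  (smooth_family_derived lZ oW ih)) => //; first exact: lcs_prod.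
by move=> k; apply: ck_pair; [exact: ck_cst|exact: ck_id].
Qed.

Lemma smooth_family_continuous Z (W : set Z) v z :
  lcs Z -> open W -> smooth_family W v -> W z ->
  {for z, continuous v}.
Proof.
move=> lZ oW jv Wz.
have : ck 0 W (fun z => pi 1%g (v z)).
  by apply: (smooth_family_ck (h := id) lZ _ oW _ jv) => //;
    [exact: group_ck_cst|exact: ck_id].
move=> /(_ z Wz); have -> : (fun z => pi 1%g (v z)) = v by apply/funext => y;
  rewrite pi1.
exact.
Qed.

Local Notation inball := (allP (fun x : E => N x <= 1)).

(* Joint continuity at [0] in the Lie algebra arguments gives a bound on small
   balls, and multilinearity extends it to the unit balls. *)
Lemma smooth_family_bounded n : forall Z (W : set Z) v z0 p,
  lcs Z -> open W -> smooth_family W v ->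
  W z0 -> csn p -> exists C, \forall z \near z0,
    forall xs, size xs = n -> inball xs -> p (foldr dpi (v z) xs) <= C.
Proof.
elim: n => [|n ih] Z W v z0 p lZ oW jv Wz cp; have sp := csnS cp.
  exists (p (v z0) + 1).
  have h : \forall z \near z0, p (v z - v z0) < 1.
    exact: (smooth_family_continuous lZ oW jv Wz (csn_ball cp (v z0) ltr01)).
  apply: filterS h => z h [|//] _ _ /=.
  by have := seminorm_split sp (v z0) (v z) 0; rewrite !subr0; lra.
have oTW : open ([set: E] `*` W) by apply: open_setX => //; exact: openT.
have [C [[A B] [/= A0 Bz] AB]] := ih _ _ _ (0, z0) p (lcs_prod lE lZ) oTW
  (smooth_family_derived lZ oW jv) (conj I Wz) cp.
have [_ _ nN _] := N_norm; have /nN[e e0 eA] := A0.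
(* The bound [C] holds for [x] with [N x < e]. Scaling the unit ball by [e / 2] lands there, and
   undoing the scaling costs the factor [(e / 2)^-1]. *)
exists ((e / 2)^-1 * C); apply: filterS2 Bz (open_nbhs_nbhs (conj oW Wz)) =>
  z Bz' Wz' xs.
(* [foldr] applies the last entry first, so it is this entry that becomes a parameter of the
   family. *)
case/lastP: xs => [//|xs x]; rewrite size_rcons -cats1 allP_cat foldr_cat =>
  -[sn] [bxs [bx _]] /=.
have sv := smooth_family_smooth lZ oW jv Wz'.
have e2 : 0 < e / 2 by rewrite divr_gt0.
have -> : dpi x (v z) = (e / 2)^-1 *: dpi ((e / 2) *: x) (v z).
  by rewrite derived_repZl// scalerA mulVf ?gt_eqF// scale1r.
rewrite foldr_derivedZ ?(seminormZ sp); last exact: smooth_derived.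
rewrite gtr0_norm ?invr_gt0// ler_pM2l ?invr_gt0//.
apply: (AB ((e / 2) *: x, z)) => //; split=> //=; apply: eA => /=.
rewrite (seminormZ (csnS csn_N)) gtr0_norm//.
by apply: (@le_lt_trans _ _ (e / 2));
  [rewrite ler_piMr// ltW|rewrite ltr_pdivrMr// ltr_pMr// ltr1n].
Qed.

Lemma smooth_bounded n v p : smooth_vector pi v -> csn p ->
  exists C, forall xs, size xs = n -> inball xs -> p (foldr dpi v xs) <= C.
Proof.
move=> sv cp.
have [C h] := smooth_family_bounded n lE (@openT E)
  (const_smooth_family lE (@openT E) sv) (I : setT (0 : E)) cp.
by exists C; exact: nbhs_singleton h.
Qed.

Local Notation dsn := (derived_seminorm pi expG N).

Lemma derived_seminorm_le p n v C :
  (forall xs, size xs = n -> inball xs -> p (foldr dpi v xs) <= C) ->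
  (dsn p n v <= C%:E)%E.
Proof.
move=> H; apply: ge_ereal_sup => _ [xs /= bxs <-].
rewrite lee_fin; apply: H; first exact: size_tuple.
have : forall i, (i < size xs)%N -> N (nth 0 xs i) <= 1.
  move=> i; rewrite size_tuple => lin; rewrite -[i]/(nat_of_ord (Ordinal lin)).
  by rewrite -tnth_nth.
elim: (tval xs) => [//|x s ih] /= Hn; split; first exact: (Hn 0%N).
by apply: ih => i; exact: (Hn i.+1).
Qed.

Lemma derived_seminorm_ge p v xs : inball xs ->
  ((p (foldr dpi v xs))%:E <= dsn p (size xs) v)%E.
Proof.
move=> bxs; apply: ereal_sup_ubound; exists (in_tuple xs) => //= i.
by rewrite (tnth_nth 0); apply: (allP_nth (P := fun x : E => N x <= 1)).
Qed.

(* Meaningful for smooth [v] only, see [snE]; otherwise [fine +oo = 0]. *)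
Definition sn p n v : R := fine (dsn p n v).

(** Shows that the supremum runs over a nonempty set, so that it is not [-oo]. *)
Lemma inball0 n : inball (nseq n (0 : E)).
Proof. by elim: n => [//|n ih]; split=> //; rewrite (seminorm0 (csnS csn_N)).
  Qed.

Section Sn.
Context (p : V -> R) (cp : csn p).

Lemma snE n v : smooth_vector pi v -> dsn p n v = (sn p n v)%:E.
Proof.
move=> sv; rewrite /sn fineK//; have [C H] := smooth_bounded n sv cp.
rewrite fin_numElt (lt_le_trans (ltNyr 0)) /=.
  by rewrite (le_lt_trans (derived_seminorm_le H))// ltry.
have := derived_seminorm_ge p v (inball0 n); rewrite size_nseq; apply: le_trans.
by rewrite lee_fin; apply: seminorm_ge0; exact: csnS.
Qed.

Lemma sn_ge v xs : smooth_vector pi v -> inball xs ->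
  p (foldr dpi v xs) <= sn p (size xs) v.
Proof.
by move=> sv bxs; rewrite -lee_fin -snE//; exact: derived_seminorm_ge.
Qed.

Lemma sn_le n v C : smooth_vector pi v ->
  (forall xs, size xs = n -> inball xs -> p (foldr dpi v xs) <= C) ->
    sn p n v <= C.
Proof. by move=> sv H; rewrite -lee_fin -snE//; exact: derived_seminorm_le. Qed.

Lemma sn_ge0 n v : smooth_vector pi v -> 0 <= sn p n v.
Proof.
move=> sv; have := sn_ge sv (inball0 n); rewrite size_nseq; apply: le_trans.
by apply: seminorm_ge0; exact: csnS.
Qed.

Lemma snD n v w : smooth_vector pi v -> smooth_vector pi w ->
  sn p n (v + w) <= sn p n v + sn p n w.
Proof.
move=> sv sw; apply: sn_le; first exact: smooth_vectorD.
move=> xs <- bxs; rewrite -[v]scale1r foldr_derived_linear// !scale1r.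
apply: le_trans (seminormD (csnS cp) _ _) _.
by apply: lerD; exact: sn_ge.
Qed.

Let snZ_le n a v : smooth_vector pi v -> sn p n (a *: v) <= `|a| * sn p n v.
Proof.
move=> sv; apply: sn_le; first exact: smooth_vectorZ.
move=> xs <- bxs; rewrite foldr_derivedZ// (seminormZ (csnS cp)).
by rewrite ler_wpM2l//; exact: sn_ge.
Qed.

Lemma snZ n a v : smooth_vector pi v -> sn p n (a *: v) = `|a| * sn p n v.
Proof.
move=> sv; apply/eqP; rewrite eq_le snZ_le//=.
have [->|a0] := eqVneq a 0.
  by rewrite normr0 mul0r sn_ge0//; exact: smooth_vectorZ.
have := snZ_le n a^-1 (smooth_vectorZ a sv).
by rewrite scalerA mulVf// scale1r normfV ler_pdivlMl ?normr_gt0.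
Qed.

Lemma snS_le n v C : smooth_vector pi v ->
  (forall x, N x <= 1 -> sn p n (dpi x v) <= C) -> sn p n.+1 v <= C.
Proof.
move=> sv H; apply: sn_le => // xs.
case/lastP: xs => [//|xs x]; rewrite size_rcons -cats1 allP_cat foldr_cat.
move=> -[sxs] [bxs [bx _]] /=; apply: le_trans (H x bx); rewrite -sxs.
by apply: sn_ge => //; exact: smooth_derived.
Qed.

Lemma sn_derived n x v : smooth_vector pi v -> sn p n (dpi x v) <=
  N x * sn p n.+1 v.
Proof.
move=> sv; have sN := csnS csn_N.
have h y : N y <= 1 -> sn p n (dpi y v) <= sn p n.+1 v.
  move=> Ny; apply: sn_le; first exact: smooth_derived.
  move=> xs <- bxs; have := @sn_ge v (rcons xs y) sv.
  by rewrite size_rcons -cats1 allP_cat foldr_cat; apply; split.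
have [Nx0|Nx0] := eqVneq (N x) 0.
  have [_ N0 _ _] := N_norm; rewrite (N0 _ Nx0) derived_rep0l//.
  rewrite (seminorm0 sN) mul0r -(scale0r 0) snZ ?normr0 ?mul0r//;
    exact: smooth_vector0.
have Npos : 0 < N x by rewrite lt_neqAle eq_sym Nx0 seminorm_ge0.
have := h ((N x)^-1 *: x); rewrite (seminormZ sN) gtr0_norm ?invr_gt0// mulVf//
  => /(_ (lexx _)).
rewrite derived_repZl// snZ; last exact: smooth_derived.
by rewrite gtr0_norm ?invr_gt0// ler_pdivrMl.
Qed.

Lemma sn0 v : smooth_vector pi v -> p v <= sn p 0 v.
Proof. by move=> sv; exact: (@sn_ge v [::] sv I). Qed.

End Sn.

Lemma exp_derivative v x s : smooth_vector pi v ->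
  (fun t : R => t^-1 *: (pi (expG ((s + t) *: x)) v - pi (expG (s *: x)) v))
    @ 0^' -->
  pi (expG (s *: x)) (dpi x v).
Proof.
move=> sv; have := cvg_comp _ _ (@derived_rep_exp _ x sv)
  (@pi_continuousr (expG (s *: x)) (dpi x v)).
apply: cvg_trans; apply: near_eq_cvg; apply: nearW => t /=.
by rewrite linearZ_LR linearB /= -piM expGD.
Qed.

(** For small [r] the mean value inequality along [s |-> exp(s r x)] bounds
    [pi(exp(r x)) a_t - a_t - r z] by a small multiple of [|r|], as [dpi x (a t)] is near [z] and
    [pi(exp(s r x))] is near the identity at [z]. Then [a t] is replaced by [b]. *)
Lemma derived_rep_closed x (a : R -> V) b z :
  (forall t, smooth_vector pi (a t)) -> smooth_vector pi b ->
  a @ 0^' --> b -> (fun t => dpi x (a t)) @ 0^' --> z -> dpi x b = z.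
Proof.
move=> sa sb ab az; apply: (lcs_cvg_unique sV (@derived_rep_exp _ x sb)).
apply/(lcs_cvgP _ _ lV) => p e cp e_gt0; have sp := csnS cp.
have [q cq qp] := pi_equicontinuous 1%g cp; have sq := csnS cq.
have e4 : 0 < e / 4 by rewrite divr_gt0.
have ez : \forall g \near (1%g : G), p (pi g z - z) < e / 4.
  have := csn_ball cp (pi 1%g z) e4 => h; have := @pi_continuousl z 1%g _ h.
  by rewrite /= pi1.
have exp1 : \forall s \near (0 : R),
  (forall v, p (pi (expG (s *: x)) v) <= q v) /\
    p (pi (expG (s *: x)) z - z) < e / 4.
  have := @expG_continuous x 0; rewrite /continuous_at scale0r expG0.
  by move=> /(_ _ (filterI qp ez)).
have /nbhs_ballP[d /= d0 dH] := exp1.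
have hd : \forall r \near (0 : R)^', ball (0 : R) d r.
  by apply: nbhs_dnbhs; exact: nbhsx_ballx.
apply: filterS2 (nbhs_dnbhs_neq (0 : R)) hd => r r0 rd.
have [rd1 rd2] := dH r rd.
have r_gt0 : 0 < `|r| by rewrite normr_gt0.
have re : 0 < `|r| * (e / 4) by rewrite mulr_gt0.
have re2 : 0 < `|r| * (e / 4) / 2 by rewrite divr_gt0.
(* The choice of [t] depends on [r]: the error [a t - b] will be divided by [r]. The shares are
   [e / 2] from the mean value inequality and twice [e / 8] from this error. *)
have [t [t1 t2 t3]] : exists t, [/\ q (a t - b) < `|r| * (e / 4) / 2,
    p (a t - b) < `|r| * (e / 4) / 2 & q (dpi x (a t) - z) < e / 4].
  apply: (@filter_ex _ (0 : R)^').
  by apply: filterS3 (cvg_csn ab cq re2) (cvg_csn ab cp re2) (cvg_csn az cq e4)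
    => t; split.
have mv : p (pi (expG (r *: x)) (a t) - a t - r *: z) <= `|r| * (e / 2).
  pose c s := pi (expG ((s * r) *: x)) (a t).
  have -> : pi (expG (r *: x)) (a t) - a t = c 1 - c 0.
    by rewrite /c mul1r mul0r scale0r expG0 pi1.
  apply: (mean_value (c' := fun s =>
    r *: pi (expG ((s * r) *: x)) (dpi x (a t))) cp).
    move=> s _; have := cvg_comp _ _ (nbhs0_scale r0)
      (@exp_derivative _ x (s * r) (sa t)).
    move=> /(@lcs_cvgZr R V R (0 : R)^' (dnbhs_filter _) r _ _ lV).
    apply: cvg_trans; apply: near_eq_cvg.
    apply: filterS (nbhs_dnbhs_neq (0 : R)) => k k0 /=.
    rewrite scalerA /c mulrDl; congr (_ *: _).
    by rewrite invfM mulrCA divff// mulr1.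
  move=> s /andP[s0 s1]; rewrite -scalerBr (seminormZ sp) ler_pM2l//.
  have /dH[h1 h2] : ball 0 d (s * r).
    move: rd; rewrite /ball /= !sub0r !normrN normrM ger0_norm//.
    by apply: le_lt_trans; rewrite ler_piMl.
  apply: le_trans (seminorm_split sp (pi (expG ((s * r) *: x)) z) _ _) _.
  have := h1 (dpi x (a t) - z); rewrite linearB /= => h3.
  by move: h2 t3; lra.
have -> : r^-1 *: (pi (expG (r *: x)) b - b) - z =
    r^-1 *: (pi (expG (r *: x)) b - b - r *: z).
  by rewrite [RHS]scalerBr scalerA mulVf// scale1r.
rewrite (seminormZ sp) normfV ltr_pdivrMl//.
apply: le_lt_trans (seminorm_split sp (pi (expG (r *: x)) (a t) - a t) _ _) _.
have -> : pi (expG (r *: x)) b - b - (pi (expG (r *: x)) (a t) - a t) =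
    pi (expG (r *: x)) (b - a t) - (b - a t).
  by rewrite (linearB (pi (expG (r *: x)))) /= !opprB addrACA [RHS]addrACA;
    congr (_ + _); exact: addrC.
have := seminormB sp (pi (expG (r *: x)) (b - a t)) (b - a t).
have := rd1 (b - a t); rewrite (seminormC sq b) (seminormC sp b).
by move: t1 t2 mv; lra.
Qed.

(* [dpi x \o pi g = pi g \o dpi (Ad g^-1 x)] moves the derivatives to [w]. *)
Lemma sn_equicontinuous (psi : chart G E) u0 n p :
  lie_atlas G psi -> cod psi u0 ->
  csn p -> exists q C, [/\ csn q, 0 <= C & \forall u \near u0,
    forall w, smooth_vector pi w -> sn p n (pi (of_model psi u) w) <=
      C * sn q n w].
Proof.
move=> Apsi cu0 cp; elim: n => [|n [q [C [cq C0 H]]]].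
  have [q cq qp] := pi_equicontinuous (of_model psi u0) cp.
  exists q, 1; split=> //.
  have h : \forall u \near u0, forall v, p (pi (of_model psi u) v) <= q v.
    exact: (of_continuous cu0 qp).
  apply: filterS h => u h w sw; apply: sn_le => //;
    first exact: smooth_translate.
  move=> [|//] _ _ /=; apply: le_trans (h w) _; rewrite mul1r; exact: sn0.
have [C' C'0 H'] := Ad_inv_bound Apsi cu0.
exists q, (C * C'); split=> //; first exact: mulr_ge0.
apply: filterS3 H H' (open_nbhs_nbhs (conj (@open_cod _ _ psi) cu0)) =>
  u H H' cu w sw.
apply: snS_le => //; first exact: smooth_translate.
move=> x Nx; rewrite derived_rep_translate//.
apply: le_trans (H _ (smooth_derived _ sw)) _; rewrite -mulrA ler_wpM2l//.
apply: le_trans (sn_derived cq _ _ sw) _; rewrite ler_wpM2r ?sn_ge0//.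
by apply: le_trans (H' x) _; rewrite ler_piMr.
Qed.

Section Orbit.
Context (psi : chart G E) (psi_atlas : lie_atlas G psi).
Local Notation kappa := (log_derivative psi).

(* The limit exists because [u |-> pi (c u) w] is a smooth family; closedness of
   the operators [dpi x] identifies it. *)
Lemma foldr_orbit_derivative xs u h w : cod psi u -> smooth_vector pi w ->
  (fun t : R => t^-1 *: (foldr dpi (pi (of_model psi (u + t *: h)) w) xs -
    foldr dpi (pi (of_model psi u) w) xs)) @ 0^' -->
  foldr dpi (pi (of_model psi u) (dpi (kappa u h) w)) xs.
Proof.
move=> cu sw; have ocod : open (cod psi) := @open_cod _ _ psi.
elim: xs => [|x xs ih]; first exact: orbit_derivative.
have so t : smooth_vector pi (pi (of_model psi t) w) by exact: smooth_translate.
have sd : smooth_vector pi (pi (of_model psi u) (dpi (kappa u h) w)).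
  by apply: smooth_translate; exact: smooth_derived.
have jv : smooth_family (cod psi)
  (fun u => foldr dpi (pi (of_model psi u) w) (x :: xs)).
  apply: (smooth_family_foldr (x :: xs) lE ocod);
    apply: smooth_family_translate => //.
    exact: const_smooth_family.
  by move=> k; exact: group_ck_of_model.
have : ck 1 (cod psi) (fun u =>
  pi 1%g (foldr dpi (pi (of_model psi u) w) (x :: xs))).
  by apply: (smooth_family_ck (h := id) lE _ ocod _ jv) => //;
    [exact: group_ck_cst|exact: ck_id].
have -> : (fun u => pi 1%g (foldr dpi (pi (of_model psi u) w) (x :: xs))) =
  (fun u => foldr dpi (pi (of_model psi u) w) (x :: xs)) by apply/funext => y;
    rewrite pi1.
move=> [_ [df [ddf _]]]; have := ddf u h cu.
suff <- : dpi x (foldr dpi (pi (of_model psi u) (dpi (kappa u h) w)) xs) =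
  df (u, h) by [].
have sf t := smooth_foldr xs (so t).
apply: (derived_rep_closed _ _ ih).
- by move=> t; apply: smooth_vectorZ; exact: smooth_vectorB.
- exact: smooth_foldr.
- have := ddf u h cu; apply: cvg_trans; apply: near_eq_cvg; apply: nearW => t.
  have /= -> := foldr_derivedZ [:: x] t^-1
    (smooth_vectorB (sf (u + t *: h)) (sf u)).
  by have /= -> := foldr_derivedB [:: x] (sf (u + t *: h)) (sf u).
Qed.

(** The mean value inequality in [V] is applied for each tuple [xs]; since [M] does not depend on
    [xs], the bound passes to the supremum. *)
Lemma sn_mean_value u h w l M p n : csn p ->
  (forall s : R, 0 <= s <= 1 -> cod psi (u + s *: h)) ->
  smooth_vector pi w -> smooth_vector pi l ->
  (forall s : R, 0 <= s <= 1 ->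
     sn p n (pi (of_model psi (u + s *: h)) (dpi (kappa (u + s *: h) h) w) - l)
       <= M) ->
  sn p n (pi (of_model psi (u + h)) w - pi (of_model psi u) w - l) <= M.
Proof.
move=> cp cus sw sl HM.
have so y : smooth_vector pi (pi (of_model psi y) w) by exact: smooth_translate.
have sd s : smooth_vector pi (pi (of_model psi (u + s *: h))
  (dpi (kappa (u + s *: h) h) w)).
  by apply: smooth_translate; exact: smooth_derived.
apply: sn_le => //; first by apply: smooth_vectorB => //; exact: smooth_vectorB.
move=> xs sxs bxs.
rewrite !foldr_derivedB//; last exact: smooth_vectorB.
pose c (s : R) := foldr dpi (pi (of_model psi (u + s *: h)) w) xs.
have -> : foldr dpi (pi (of_model psi (u + h)) w) xs =
  c 1 by rewrite /c scale1r.
have -> : foldr dpi (pi (of_model psi u) w) xs =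
  c 0 by rewrite /c scale0r addr0.
apply: (mean_value (c' := fun s => foldr dpi (pi (of_model psi (u + s *: h))
  (dpi (kappa (u + s *: h) h) w)) xs) cp) => s s01.
  have := @foldr_orbit_derivative xs (u + s *: h) h w (cus s s01) sw.
  apply: cvg_trans; apply: near_eq_cvg; apply: nearW => t.
  by rewrite /c scalerDl addrA.
rewrite -foldr_derivedB//; apply: le_trans (HM s s01); rewrite -sxs.
by apply: sn_ge => //; exact: smooth_vectorB.
Qed.

Lemma segment_near (A : set E) u : nbhs u A ->
  exists2 q, csn q & forall h (s : R), q h < 1 -> 0 <= s <= 1 -> A (u + s *: h).
Proof.
move=> /lE[q cq qA]; exists q => // h s qh /andP[s0 s1]; apply: qA.
rewrite addrAC subrr add0r (seminormZ (csnS cq)) ger0_norm//.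
by apply: le_lt_trans qh; rewrite ler_piMl// (seminorm_ge0 (csnS cq)).
Qed.

Lemma sn_orbit_continuous u0 w p n e : cod psi u0 -> smooth_vector pi w ->
  csn p -> 0 < e ->
  \forall u \near u0, sn p n (pi (of_model psi u) w - pi (of_model psi u0) w) <
    e.
Proof.
move=> cu0 sw cp e_gt0.
have [q [C [cq C0 H]]] := sn_equicontinuous n psi_atlas cu0 cp.
have [C' C'0 H'] := log_derivative_bound psi_atlas cu0.
have ocod := open_nbhs_nbhs (conj (@open_cod _ _ psi) cu0).
have [r cr Hr] := segment_near (filterI ocod (filterI H H')).
(* Bounds the derivative on the segment: [C] for the translation, [C'] for the logarithmic
   derivative, and order [n.+1] for the additional [dpi]. *)
pose K := C * (C' * sn q n.+1 w).
have K0 : 0 <= K by rewrite !mulr_ge0// sn_ge0.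
have eK : 0 < e / (K + 1) by rewrite divr_gt0// ltr_wpDl.
apply: filterS2 (csn_ball cr u0 ltr01) (csn_ball csn_N u0 eK) => u ru Nu.
have bound : sn p n (pi (of_model psi (u0 + (u - u0))) w - pi (of_model psi u0)
  w - 0) <=
    K * N (u - u0).
  apply: sn_mean_value => //; first by move=> s /(Hr _ _ ru)[].
    exact: smooth_vector0.
  move=> s /(Hr _ _ ru)[_ [h h']]; rewrite subr0.
  apply: le_trans (h _ (smooth_derived _ sw)) _; rewrite -mulrA ler_wpM2l//.
  apply: le_trans (sn_derived cq _ _ sw) _; rewrite mulrAC.
  by rewrite ler_wpM2r ?sn_ge0//; exact: h'.
move: bound; rewrite subr0 subrKC => /le_lt_trans; apply.
have N0 := seminorm_ge0 (csnS csn_N) (u - u0).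
by move: Nu => /=; rewrite ltr_pdivlMr ?ltr_wpDl// mulrDr mulr1 (mulrC _ K);
  lra.
Qed.

End Orbit.

(** * The locally convex space of smooth vectors *)

Local Notation W := (smooth_space pi expG N).
Local Notation wval := (@smooth_val R E G V pi expG N).

Lemma smooth_val_smooth (w : W) : smooth_vector pi (wval w).
Proof. by apply/asboolP; exact: smooth_valP. Qed.

Definition to_smooth v (sv : smooth_vector pi v) :
  W := SmoothSpace expG N (asboolT sv).

Lemma smooth_val_linear : linear wval.
Proof. by []. Qed.

Lemma smooth_val_inj : injective wval.
Proof. exact: val_inj. Qed.

Definition space_seminorm p n (w : W) : R := sn p n (wval w).

Lemma space_seminorm_seminorm p n : csn p -> seminorm (space_seminorm p n).
Proof.
move=> cp; split=> [v w|a v]; rewrite /space_seminorm.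
  by apply: snD => //; exact: smooth_val_smooth.
by apply: snZ => //; exact: smooth_val_smooth.
Qed.

Lemma csn_space_seminorm p n : csn p -> csn (space_seminorm p n).
Proof.
move=> cp; split; first exact: space_seminorm_seminorm.
move=> w e e_gt0; pose B := [set v : W | space_seminorm p n (v - w) < e].
suff oB : open B.
  apply: (open_nbhs_nbhs (A := B)); split=> //.
  by rewrite /B /= subrr (seminorm0 (space_seminorm_seminorm n cp)).
exists [set B]; last by rewrite bigcup_set1.
move=> _ ->; exists [fset B]%fset; last first.
  by rewrite set_fset1 bigcap_set1.
move=> _ /[!inE] /eqP ->; apply/mem_set; exists p, n, w, e; split=> //.
- exact: csnS.
- exact: csn_continuous.
- have E' v : dsn p n (wval v - wval w) = (space_seminorm p n (v - w))%:E.
    exact: (snE cp n (smooth_val_smooth (v - w))).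
  by apply/seteqP; split=> v; rewrite /B /= E' lte_fin.
Qed.

(** The finitely many subbasic balls given by the topology may be centred anywhere; the triangle
    inequality puts a smaller ball around [w] into each. *)
Lemma nbhs_smooth_space (w : W) (A : set W) : nbhs w A ->
  exists2 s : seq (set W),
    forall B, B \in s -> exists p n e, [/\ csn p, 0 < e &
      forall v, space_seminorm p n (v - w) < e -> B v] &
    forall v, (forall B, B \in s -> B v) -> A v.
Proof.
rewrite nbhsE => -[_ [[Bs sB <-] [C BC Cw] UA]].
have /sB [D sD IDeC] := BC.
have {IDeC} CE : C = \bigcap_(B in [set` D]) B by rewrite -IDeC.
have {}Cw : C w := Cw.
exists (enum_fset D) => [B DB|v Dv]; last first.
  apply: UA; exists C => //; suff : C v by [].
  by rewrite CE => B DB; exact: Dv.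
have [p [n [v [e [sp cp e_gt0 BE]]]]] := set_mem (sD B DB).
have cp' := continuous_csn sp cp.
have {}BE : B = [set y | space_seminorm p n (y - v) < e].
  have E' y : dsn p n (wval y - wval v) = (space_seminorm p n (y - v))%:E.
    exact: (snE cp' n (smooth_val_smooth (y - v))).
  by rewrite BE; apply/seteqP; split=> y; rewrite /= E' lte_fin.
have Bw : B w by move: Cw; rewrite CE; exact.
rewrite BE /= in Bw.
exists p, n, (e - space_seminorm p n (w - v)); split=> //;
  first by rewrite subr_gt0.
move=> y yw; rewrite BE /=.
by have := seminorm_split (space_seminorm_seminorm n cp') w y v; lra.
Qed.

Lemma smooth_space_cvg (T : Type) (fl : set_system T) {ff : Filter fl}
    (g : T -> W) (w : W) :
  (forall p n e, csn p -> 0 < e -> \forall t \near fl,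
    space_seminorm p n (g t - w) < e) ->
  g @ fl --> w.
Proof.
move=> H A /nbhs_smooth_space[s sB sA].
suff : \forall t \near fl, forall B, B \in s -> B (g t).
  by apply: filterS => t; exact: sA.
elim: s sB {sA} => [|B s ih] sB; first by apply: nearW.
have [p [n [e [cp e_gt0 BH]]]] := sB B (mem_head _ _).
have h := H p n e cp e_gt0.
have h' : \forall t \near fl, forall B, B \in s -> B (g t).
  by apply: ih => B' B's; apply: sB; rewrite in_cons B's orbT.
apply: filterS2 h h' => t ht ht' B'; rewrite in_cons => /orP[/eqP ->|];
  last exact: ht'.
exact: BH.
Qed.

(** The finitely many balls contain the unit ball of one seminorm, the sum of the seminorms rescaled
    by their radii. *)
Lemma lcs_smooth_space : lcs W.
Proof.
move=> w A /nbhs_smooth_space[s sB sA].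
suff [r cr rB] : exists2 r : W -> R, csn r & forall v,
  r (v - w) < 1 -> forall B, B \in s -> B v.
  by exists r => // v /rB; exact: sA.
elim: s sB {sA} => [|B s ih] sB; first by exists (fun _ => 0) => //;
  exact: csn0.
have [p [n [e [cp e_gt0 BH]]]] := sB B (mem_head _ _).
have [B' B's|r cr rB] := ih; first by apply: sB; rewrite in_cons B's orbT.
have ce : csn (fun v => e^-1 * space_seminorm p n v).
  by apply: csnZ; [rewrite invr_ge0 ltW|exact: csn_space_seminorm].
exists (fun v => e^-1 * space_seminorm p n v + r v) => [|v rv B'];
  first exact: csnD.
have r0 := seminorm_ge0 (csnS cr) (v - w).
have p0 := seminorm_ge0 (csnS ce) (v - w).
rewrite in_cons => /orP[/eqP ->|]; last by apply: rB; lra.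
apply: BH; have : e^-1 * space_seminorm p n (v - w) < 1 by lra.
by rewrite ltr_pdivrMl// mulr1.
Qed.

Lemma separated_smooth_space : separated W.
Proof.
move=> w H; apply: smooth_val_inj; apply: sV => p cp.
apply/eqP; rewrite eq_le (seminorm_ge0 (csnS cp)) andbT.
apply: le_trans (sn0 cp (smooth_val_smooth w)) _.
by rewrite -[leLHS]/(space_seminorm p 0 w) (H _ (csn_space_seminorm 0 cp)).
Qed.

(** * Smoothness of the action *)

Definition saction (psi : chart G E) (z : E * W) : W :=
  to_smooth (smooth_translate (of_model psi z.1) (smooth_val_smooth z.2)).

Definition daction (z : E * W) : W :=
  to_smooth (smooth_derived z.1 (smooth_val_smooth z.2)).

Let lW : lcs W := lcs_smooth_space.
Let sW : separated W := separated_smooth_space.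

Lemma space_seminorm_daction p n x w :
  csn p -> space_seminorm p n (daction (x, w)) <= N x * space_seminorm p n.+1 w.
Proof. by move=> cp; apply: sn_derived => //; exact: smooth_val_smooth. Qed.

Lemma daction_linearl w : linear (fun x => daction (x, w)).
Proof.
move=> a x y; apply: smooth_val_inj; rewrite smooth_val_linear.
exact: (derived_rep_linearl (smooth_val_smooth w)).
Qed.

Lemma daction_linearr x : linear (fun w => daction (x, w)).
Proof.
move=> a v w; apply: smooth_val_inj; rewrite smooth_val_linear.
exact: (derived_rep_linearr x a (smooth_val_smooth v) (smooth_val_smooth w)).
Qed.

Lemma daction_continuous : continuous daction.
Proof.
move=> [x w]; apply: smooth_space_cvg => p n e cp e_gt0.
pose a := space_seminorm p n.+1 w; have sp' := space_seminorm_seminorm n.+1 cp;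
  have sp := space_seminorm_seminorm n cp.
have a0 : 0 <= a by exact: seminorm_ge0.
have sN := csnS csn_N; have Nx0 := seminorm_ge0 sN x.
(* The minimum with 1 ensures [N y <= N x + 1], which bounds the operator [daction (y, -)]
   independently of [y]. *)
have e1 : 0 < Num.min 1 (e / 2 / (a + 1)) by rewrite lt_min ltr01 !divr_gt0//
  ltr_wpDl.
have e2 : 0 < e / 2 / (N x + 1) by rewrite !divr_gt0// ltr_wpDl.
exists ([set y | N (y - x) < Num.min 1 (e / 2 / (a + 1))],
        [set v | space_seminorm p n.+1 (v - w) < e / 2 / (N x + 1)]).
  by split; apply: csn_ball => //; [exact: csn_N|exact: csn_space_seminorm].
move=> [y v] [] /=; rewrite lt_min => /andP[y1 y2] vw.
have -> : daction (y, v) - daction (x, w) = daction (y, v - w) +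
  daction (y - x, w).
  rewrite (linearB_of (daction_linearr y)) (linearB_of (daction_linearl w)).
  by rewrite addrA subrK.
apply: le_lt_trans (seminormD sp _ _) _.
have h1 := space_seminorm_daction n y (v - w) cp;
  have h2 := space_seminorm_daction n (y - x) w cp.
have Ny : N y <= N x + 1.
  by have := seminorm_split sN x y 0; rewrite !subr0; lra.
have h3 := seminorm_ge0 sp' (v - w); have h4 := seminorm_ge0 sN (y - x).
move: y2 vw; rewrite !ltr_pdivlMr ?ltr_wpDl// -/a in h2 *.
by have := seminorm_ge0 sN y; nra.
Qed.

Section ChartAction.
Context (psi : chart G E) (psi_atlas : lie_atlas G psi).
Local Notation S := (saction psi).

Lemma saction_linear u : linear (fun w => S (u, w)).
Proof. by move=> a v w; apply: smooth_val_inj;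
  rewrite smooth_val_linear /= linearP. Qed.

(** Equicontinuity near [u] handles the change of the vector, continuity of the single orbit of [w]
    that of the group element. *)
Lemma saction_continuous z : cod psi z.1 -> {for z, continuous S}.
Proof.
case: z => u w /= cu; apply: smooth_space_cvg => p n e cp e_gt0.
have sp := space_seminorm_seminorm n cp.
have [q [C [cq C0 H]]] := sn_equicontinuous n psi_atlas cu cp.
have e2 : 0 < e / 2 by rewrite divr_gt0.
have e3 : 0 < e / 2 / (C + 1) by rewrite !divr_gt0// ltr_wpDl.
have h := sn_orbit_continuous psi_atlas n cu (smooth_val_smooth w) cp e2.
exists ([set y | (forall v, smooth_vector pi v ->
      sn p n (pi (of_model psi y) v) <= C * sn q n v) /\
      sn p n (pi (of_model psi y) (wval w) - pi (of_model psi u) (wval w)) < e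
        / 2],
    [set v | space_seminorm q n (v - w) < e / 2 / (C + 1)]).
  split; first exact: filterI H h.
  by apply: csn_ball => //; exact: csn_space_seminorm.
move=> [y v] [] /= [Hy hy] vw.
have -> : S (y, v) - S (u, w) = S (y, v - w) + (S (y, w) - S (u, w)).
  by rewrite (linearB_of (saction_linear y)) addrA subrK.
apply: le_lt_trans (seminormD sp _ _) _.
have := Hy _ (smooth_val_smooth (v - w));
  rewrite -/(space_seminorm q n (v - w)).
rewrite -[sn p n _]/(space_seminorm p n (S (y, v - w))) => h1.
have h2 := seminorm_ge0 (space_seminorm_seminorm n cq) (v - w).
move: hy; rewrite -[sn p n _]/(space_seminorm p n (S (y, w) - S (u, w))).
move: vw; rewrite ltr_pdivlMr ?ltr_wpDl//; nra.
Qed.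

(** By linearity in the vector the quotient is exactly the one in direction [h] at fixed [w], plus
    [S (u + t *: h, z)]. The first part is a mean value estimate against the continuous function
    [Phi], the second is continuity of [S]. *)
Lemma saction_diffquot u w h z : cod psi u ->
  diffquot S (h, z) (u, w) t @[t --> 0^'] -->
  S (u, daction (log_derivative psi u h, w) + z).
Proof.
move=> cu; have ocod := open_nbhs_nbhs (conj (@open_cod _ _ psi) cu).
pose Phi y := S (y, daction (log_derivative psi y h, w)).
have first_part : (fun t : R => t^-1 *: (S (u + t *: h, w) - S (u, w))) @ 0^'
  --> Phi u.
  apply: smooth_space_cvg => p n e cp e_gt0;
    have sp := space_seminorm_seminorm n cp.
  have cPhi : {for u, continuous Phi}.
    apply: (@continuous_comp _ _ _
      (fun y => (y, daction (log_derivative psi y h, w))) S).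
      apply: continuous_pair; first exact: cvg_id.
      apply: (@continuous_comp _ _ _ (fun y => (log_derivative psi y h, w))
        daction).
        apply: continuous_pair; last exact: const_continuous.
        have := ck_cont (x := (u, h)) (log_derivative_ck psi_atlas 0)
          (conj cu I).
        apply: (@continuous_comp _ _ _ (fun y => (y, h))
          (fun z : E * E => log_derivative psi z.1 z.2)).
        by apply: continuous_pair; [exact: cvg_id|exact: const_continuous].
      exact: daction_continuous.
    exact: saction_continuous.
  have e2 : 0 < e / 2 by rewrite divr_gt0.
  have nPhi : \forall y \near u, space_seminorm p n (Phi y - Phi u) < e / 2.
    exact: (cPhi _ (csn_ball (csn_space_seminorm n cp) (Phi u) e2)).
  have [q cq qH] := segment_near (filterI ocod nPhi).
  have tq : \forall t \near (0 : R), q (t *: h) < 1.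
    have := near_line h lE (csn_ball cq (0 : E) ltr01).
    by apply: filterS => t /=; rewrite add0r subr0.
  apply: filterS2 (nbhs_dnbhs_neq (0 : R)) (nbhs_dnbhs tq) => t t0 th.
  have st s : 0 <= s <= 1 -> cod psi (u + s *: (t *: h)) /\
      space_seminorm p n (Phi (u + s *: (t *: h)) - Phi u) < e / 2 by exact: qH.
  have t_gt0 : 0 < `|t| by rewrite normr_gt0.
  have mv : space_seminorm p n (S (u + t *: h, w) - S (u, w) - t *: Phi u) <=
    `|t| * (e / 2).
    (* Linearity of the logarithmic derivative takes [t] out of the increment [t *: h]; what remains
       is the oscillation of [Phi] on the segment. *)
    apply: (sn_mean_value psi_atlas cp) => [s /st[]//|||s /st[cs Hs]].
    - exact: smooth_val_smooth.
    - exact: (smooth_val_smooth (t *: Phi u)).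
    - set y := u + s *: (t *: h).
      have E' : pi (of_model psi y) (dpi (log_derivative psi y (t *: h))
        (wval w)) -
          wval (t *: Phi u) = wval (t *: (Phi y - Phi u)).
        have -> : log_derivative psi y (t *: h) = t *: log_derivative psi y h.
          exact: (linearZ_of (log_derivative_linear psi_atlas cs)).
        rewrite derived_repZl; last exact: smooth_val_smooth.
        have -> : wval (t *: (Phi y - Phi u)) = t *:
          (wval (Phi y) - wval (Phi u)) by [].
        by rewrite (linearZ_LR (pi (of_model psi y))) /= scalerBr.
      rewrite E' -[sn _ _ _]/(space_seminorm p n (t *: (Phi y - Phi u)))
        (seminormZ sp) ler_pM2l//.
      exact: ltW.
  have -> : t^-1 *: (S (u + t *: h, w) - S (u, w)) - Phi u =
      t^-1 *: (S (u + t *: h, w) - S (u, w) - t *: Phi u).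
    by rewrite [RHS]scalerBr scalerA mulVf// scale1r.
  rewrite (seminormZ sp) normfV ltr_pdivrMl//; apply: le_lt_trans mv _.
  by rewrite ltr_pM2l// ltr_pdivrMr// ltr_pMr// ltr1n.
have second_part : (fun t : R => S (u + t *: h, z)) @ 0^' --> S (u, z).
  have cS : {for (0 : R), continuous (fun t : R => S (u + t *: h, z))}.
    apply: (@continuous_comp _ _ _ (fun t : R => (u + t *: h, z)) S).
      by apply: continuous_pair; [exact: line_continuous|exact:
        const_continuous].
    by apply: saction_continuous; rewrite /= scale0r addr0.
  have := cvg_trans (cvg_app _ (@nbhs_dnbhs _ (0 : R))) cS.
  by rewrite scale0r addr0.
rewrite (_ : S (u, _ + _) = Phi u + S (u, z)); last first.
  by have := saction_linear u 1 (daction (log_derivative psi u h, w)) z;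
    rewrite !scale1r.
have := @lcs_cvgD R W R (0 : R)^' (dnbhs_filter _) _ _ _ _ lW first_part
  second_part.
apply: cvg_trans; apply: near_eq_cvg.
apply: filterS (nbhs_dnbhs_neq (0 : R)) => t t0 /=.
have E' : S (u + t *: h, w + t *: z) = t *:
  S (u + t *: h, z) + S (u + t *: h, w).
  by rewrite [w + _]addrC saction_linear.
rewrite /diffquot [(u, w) + _](_ : _ = (u + t *: h, w + t *: z))// E'.
by rewrite -addrA [RHS]scalerDr scalerA mulVf// scale1r; exact: addrC.
Qed.

(* The derivative of [S] is [S] composed with smooth maps, so that [C^k]
   implies [C^k.+1]. *)
Lemma saction_ck k : ck k (cod psi `*` [set: W]) S.
Proof.
have cS z : (cod psi `*` [set: W]) z -> {for z, continuous S}.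
  by case=> cz _; exact: saction_continuous.
elim: k => [|k ih]; first exact: cS.
split; first exact: cS.
pose EW := (E * W)%type; have lEW : lcs EW := lcs_prod lE lW.
have lEW2 : lcs (EW * EW)%type := lcs_prod lEW lEW.
have oD : open (cod psi `*` [set: W]) by apply: open_setXT; exact: open_cod.
have oD2 : open ((cod psi `*` [set: W]) `*` [set: EW]) by exact: open_setXT.
exists (fun q : EW * EW => S (q.1.1,
  daction (log_derivative psi q.1.1 q.2.1, q.1.2) + q.2.2)); split.
  by move=> [u w] [h z] [/= cu _]; exact: saction_diffquot.
apply: (ck_comp (V := cod psi `*` [set: W]) (f := fun q : EW * EW => (q.1.1,
  daction (log_derivative psi q.1.1 q.2.1, q.1.2) + q.2.2)) (g := S)) => //;
    last first.
  by move=> q [[cq _] _].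
apply: ck_pair; first by apply: ck_fst; exact: ck_proj1.
apply: ck_add => //; last by apply: ck_snd; exact: ck_proj2.
apply: (ck_bilinear lE lW lW daction_linearl daction_linearr
  daction_continuous) => //.
  apply: (ck_comp (V := cod psi `*` [set: E]) (f := fun q : EW * EW =>
    (q.1.1, q.2.1))
    (g := fun z : E * E => log_derivative psi z.1 z.2)) => //.
  - exact: lcs_prod.
  - by apply: open_setXT; exact: open_cod.
  - by apply: ck_pair; apply: ck_fst; [exact: ck_proj1|exact: ck_proj2].
  - exact: log_derivative_ck.
  - by move=> q [[cq _] _].
by apply: ck_snd; exact: ck_proj1.
Qed.

End ChartAction.

Definition smooth_action (z : G * W) :
  W := to_smooth (smooth_translate z.1 (smooth_val_smooth z.2)).

Lemma smooth_action_smooth_map :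
  smooth_map (prod_atlas (lie_atlas G) (vect_atlas W)) (vect_atlas W)
    smooth_action.
Proof.
split.
  move=> [g w]; have [psi Apsi cg] := (lie_atlasP G).1 g.
  (* Near [(g, w)] the action is [saction] read in a chart around [g]. *)
  have cS : {for (g, w), continuous (fun z : G * W =>
    saction psi (to_model psi z.1, z.2))}.
    apply: (@continuous_comp _ _ _ (fun z : G * W => (to_model psi z.1, z.2))
      (saction psi)).
      apply: continuous_pair; last exact: cvg_snd.
      by apply: (@continuous_comp _ _ _ fst (to_model psi));
        [exact: cvg_fst|exact: to_continuous].
    by apply: saction_continuous => //; exact: to_cod.
  have E' (z : G * W) : dom psi z.1 -> saction psi (to_model psi z.1, z.2) =
    smooth_action z.
    by move=> dz; apply: smooth_val_inj; rewrite /= to_modelK.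
  move: cS; rewrite /prop_for /continuous_at /= (E' (g, w))//; apply: cvg_trans.
  apply: near_eq_cvg; exists (dom psi, setT) => /=.
    split; last exact: filterT.
    by apply: open_nbhs_nbhs; split=> //; exact: open_dom.
  by move=> z [/= dz _]; rewrite E'.
(* The charts on the vector space side are identities, so the local representative of the action is
   [saction psi]. *)
move=> _ _ [psi Apsi [_ -> <-]] ->.
have oD : open (cod psi `*` [set: W]) by apply: open_setXT; exact: open_cod.
have := ck_smooth_on (lcs_prod lE lW) lW oD sW (saction_ck Apsi).
have -> // : [set u | cod (prod_chart psi (id_chart W)) u /\
    dom (id_chart W) (smooth_action
      (of_model (prod_chart psi (id_chart W)) u))] = cod psi `*` [set: W].
by apply/seteqP; split=> [u []|u].
Qed.

End Rep.

Theorem theorem4p4 (R : realType) (E : completeNormedModType R)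
    (G : lieGroupType E) (V : hausdorffTvsType R)
    (pi : G -> {linear V -> V})
    (pi_rep : is_representation pi)
    (pi_continuous : continuous (fun p : G * V => pi p.1 p.2))
    (phi : chart G E) (phi_atlas : lie_atlas G phi) (phi1 : dom phi 1%g)
    (N : E -> R) (N_norm : lie_algebra_norm phi N)
    (expG : E -> G) (expG_exp : is_exponential phi expG) :
  exists sigma : G * smooth_space pi expG N -> smooth_space pi expG N,
    (forall g v, smooth_val (sigma (g, v)) = pi g (smooth_val v)) /\
    smooth_map
      (prod_atlas (lie_atlas G) (vect_atlas (smooth_space pi expG N)))
      (vect_atlas (smooth_space pi expG N)) sigma.
Proof.
exists (smooth_action pi_rep pi_continuous N_norm (expG := expG)); split=> //.
exact: (smooth_action_smooth_map pi_rep pi_continuous phi_atlas phi1 N_norm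
  expG_exp).
Qed.
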